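(* Let $X$ be any Banach space, let $K\subset X^*$ be weak*-compact, and let $L=\overline{\mathrm{co}}^{w^*}(K)$ be the weak*-closed convex hull of $K$. Then $Sz(L)=\Gamma(Sz(K))$.
   Context: Banach spaces are over the real or complex scalars. For a Banach space $X$, a weak*-compact $K\subset X^*$ and $\varepsilon>0$, let $s_\varepsilon(K)$ be the set of all $x^*\in K$ such that for every weak*-neighborhood $V$ of $x^*$, $\mathrm{diam}(V\cap K)>\varepsilon$ (norm diameter). Define $s^0_\varepsilon(K)=K$, $s^{\xi+1}_\varepsilon(K)=s_\varepsilon(s^\xi_\varepsilon(K))$, and $s^\xi_\varepsilon(K)=\bigcap_{\zeta<\xi}s^\zeta_\varepsilon(K)$ for limit ordinals $\xi$. Let $Sz_\varepsilon(K)=\min\{\xi: s^\xi_\varepsilon(K)=\varnothing\}$ if such an ordinal $\xi$ exists, and $Sz_\varepsilon(K)=\infty$ otherwise. Let $Sz(K)=\sup_{\varepsilon>0}Sz_\varepsilon(K)$, which is $\infty$ if $Sz_\varepsilon(K)=\infty$ for some $\varepsilon>0$. By convention $\xi<\infty$ for every ordinal $\xi$. A gamma number is an ordinal which is greater than the sum of any two lesser ordinals; $0$ is a gamma number, and the non-zero gamma numbers are exactly the ordinals $\omega^\xi$. For an ordinal $\xi$, $\Gamma(\xi)$ denotes the least gamma number which is not less than $\xi$, and $\Gamma(\infty)=\infty$. *)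

(* Defs.v *)
From HB Require Import structures.
From mathcomp Require Import all_boot all_order all_algebra.
From mathcomp Require Import complex.
From mathcomp Require Import all_classical all_reals all_analysis.

Set Implicit Arguments.
Unset Strict Implicit.
Unset Printing Implicit Defensive.
Import Order.TTheory GRing.Theory Num.Theory.
Import numFieldNormedType.Exports.

Local Open Scope classical_set_scope.
Local Open Scope ring_scope.

(* [node f] represents the least ordinal strictly above every [f i].  The
   index types range over a universe that contains the Banach spaces below
   (this is enforced by [derived_stationary]), so that there are enough
   ordinals for the transfinite derivations to become stationary.  As a
   consequence [tree] and [ord] live in a universe that is too large for the
   universe-monomorphic [set], [\bigcap], [eqType], etc.: predicates on them
   are written [_ -> Prop]. *)
Inductive tree : Type := node (A : Type) of (A -> tree).

Fixpoint tle (s t : tree) : Prop :=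
  let: node A f := s in let: node B g := t in
  forall i, exists j, tle (f i) (g j).

Definition tlt (s t : tree) : Prop :=
  let: node B g := t in exists j, tle s (g j).

Definition teq (s t : tree) : Prop := tle s t /\ tle t s.

(* s + t = sup (s, {s + t' + 1 : t' < t}) *)
Fixpoint tadd (s t : tree) : tree :=
  let: node A f := s in let: node B g := t in
  node (fun i : A + B => match i with inl a => f a | inr b => tadd s (g b) end).

Lemma tle_refl s : tle s s.
Proof. by elim: s => A f IH /= i; exists i. Qed.

Lemma tle_trans t s u : tle s t -> tle t u -> tle s u.
Proof.
elim: s t u => A f IH [B g] [C h] /= st tu i.
have [j fg] := st i; have [k gh] := tu j.
by exists k; exact: IH fg gh.
Qed.

Lemma tNle s t : ~ tle s t -> tlt t s.
Proof.
elim: s t => A f IH [B g] /= /existsNP[i Hi]; exists i.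
case Ef : (f i) => [C h] /= j.
have /IH : ~ tle (f i) (g j) by move=> Hj; apply: Hi; exists j.
by rewrite Ef.
Qed.

Lemma tlt_Nle s t : tlt s t -> ~ tle t s.
Proof.
elim: t s => B g IH [A f] /= [j Hj] ts.
have [i Hi] := ts j.
by apply: (IH j (f i)) => //; case Eg : (g j) Hj => [C h] /= /(_ i).
Qed.

Lemma tltP s t : tlt s t <-> ~ tle t s.
Proof. by split; [exact: tlt_Nle|exact: tNle]. Qed.

Lemma teq_class s t : teq s t <-> teq s = teq t.
Proof.
split=> [[st ts]|->]; last by split; exact: tle_refl.
apply/funext => u; apply/propext; split=> -[h1 h2]; split.
- exact: tle_trans ts h1.
- exact: tle_trans h2 st.
- exact: tle_trans st h1.
- exact: tle_trans h2 ts.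
Qed.

Lemma tle_node A (f : A -> tree) t : tle (node f) t <-> forall i, tlt (f i) t.
Proof. by case: t. Qed.

Lemma tltW s t : tlt s t -> tle s t.
Proof.
elim: t s => B g IH [A f] [j /tle_node Hj].
by apply/tle_node => i; exists j; exact: (IH j _ (Hj i)).
Qed.

(* an ordinal is an equivalence class of trees, so that equality of ordinals is
   Leibniz equality *)
Record ord : Type := MkOrd {
  ord_class : tree -> Prop;
  ord_classP : exists t, ord_class = teq t }.

Definition ord_of (t : tree) : ord := MkOrd (ex_intro _ t erefl).
Definition ord_repr (a : ord) : tree := projT1 (cid (ord_classP a)).

Lemma ord_reprE a : ord_class a = teq (ord_repr a).
Proof. exact: projT2 (cid (ord_classP a)). Qed.

Lemma ord_ext a b : ord_class a = ord_class b -> a = b.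
Proof.
by case: a b => [c cP] [c' cP'] /= E; subst c'; congr MkOrd; exact: Prop_irrelevance.
Qed.

Lemma ord_reprK a : ord_of (ord_repr a) = a.
Proof. by apply: ord_ext; rewrite [RHS]ord_reprE. Qed.

Lemma ord_ofK t : teq (ord_repr (ord_of t)) t.
Proof. by apply/teq_class; rewrite -ord_reprE. Qed.

Definition ole (a b : ord) : Prop := tle (ord_repr a) (ord_repr b).
Definition olt (a b : ord) : Prop := ole a b /\ a <> b.

Lemma ole_refl a : ole a a. Proof. exact: tle_refl. Qed.

Lemma ole_trans b a c : ole a b -> ole b c -> ole a c.
Proof. exact: tle_trans. Qed.

Lemma ole_anti a b : ole a b -> ole b a -> a = b.
Proof.
by move=> ab ba; apply: ord_ext; rewrite !ord_reprE; apply/teq_class; split.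
Qed.

Lemma oltNge a b : olt a b <-> ~ ole b a.
Proof.
split=> [[ab neq] ba|nba]; first exact/neq/ole_anti.
split; first exact/tltW/tNle.
by move=> E; apply: nba; rewrite E; exact: ole_refl.
Qed.

Lemma oltE a b : olt a b <-> tlt (ord_repr a) (ord_repr b).
Proof. by split=> [/oltNge/tNle|/tlt_Nle/oltNge]. Qed.

Lemma oleNgt a b : ole a b <-> ~ olt b a.
Proof. by rewrite (propext (oltNge b a)) notK. Qed.

Lemma olt_ole a b : olt a b -> ole a b. Proof. by case. Qed.

Lemma ole_total a b : ole a b \/ ole b a.
Proof.
by have [|nab] := pselect (ole a b); [left|right; apply/olt_ole/oltNge].
Qed.

Lemma ole_lt_trans b a c : ole a b -> olt b c -> olt a c.
Proof.
move=> ab /oltNge bc; apply/oltNge => ca; exact: (bc (ole_trans ca ab)).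
Qed.

Lemma olt_le_trans b a c : olt a b -> ole b c -> olt a c.
Proof.
move=> /oltNge ab bc; apply/oltNge => ca; exact: (ab (ole_trans bc ca)).
Qed.

Lemma olt_irr a : ~ olt a a. Proof. by case. Qed.

Lemma ole_of s t : ole (ord_of s) (ord_of t) <-> tle s t.
Proof.
have [s1 s2] := ord_ofK s; have [t1 t2] := ord_ofK t.
split=> h; first exact: tle_trans s2 (tle_trans h t1).
exact: tle_trans s1 (tle_trans h t2).
Qed.

Lemma olt_wf : well_founded olt.
Proof.
suff H t a : tle (ord_repr a) t -> Acc olt a.
  by move=> a; exact: H (tle_refl _).
elim: t a => A f IH a aA; constructor => b /oltE.
case Ea : (ord_repr a) aA => [B g] /= aA [j bj].
by have [i gi] := aA j; apply: (IH i); exact: tle_trans bj gi.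
Qed.

(* the least ordinal strictly above all the [f i] (see [oaboveP]) *)
Definition oabove (A : Type) (f : A -> ord) : ord :=
  ord_of (node (fun i => ord_repr (f i))).

Lemma oaboveP (A : Type) (f : A -> ord) b :
  ole (oabove f) b <-> forall i, olt (f i) b.
Proof.
rewrite -{1}(ord_reprK b) (propext (ole_of _ _)) (propext (tle_node _ _)).
by split=> H i; apply/oltE.
Qed.

Definition ozero : ord := oabove (fun e : Empty_set => match e with end).
Definition osucc (a : ord) : ord := oabove (fun _ : unit => a).
Definition oadd (a b : ord) : ord := ord_of (tadd (ord_repr a) (ord_repr b)).
Definition olimit (a : ord) : Prop := a <> ozero /\ forall b, a <> osucc b.

Lemma ole0 a : ole ozero a. Proof. by apply/oaboveP => -[]. Qed.

Lemma osuccP a b : ole (osucc a) b <-> olt a b.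
Proof. by rewrite (propext (oaboveP _ _)); split=> [/(_ tt)|]. Qed.

Lemma olt_succ a : olt a (osucc a). Proof. exact/osuccP/ole_refl. Qed.

Lemma osucc_inj a b : osucc a = osucc b -> a = b.
Proof.
have H c d : osucc c = osucc d -> ole c d.
  move=> E; apply/oleNgt => /osuccP; rewrite -E => /oleNgt; apply.
  exact: olt_succ.
by move=> E; apply: ole_anti; exact: H.
Qed.

Lemma osucc_neq0 a : osucc a <> ozero.
Proof. by move=> E; have /oltNge := olt_succ a; apply; rewrite E; exact: ole0. Qed.

Lemma tadd_lel s t : tle s (tadd s t).
Proof.
by case: s t => A f [B g] /= i; exists (inl i); exact: tle_refl.
Qed.

Lemma tadd_mono s s' t t' : tle s s' -> tle t t' -> tle (tadd s t) (tadd s' t').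
Proof.
move=> ss; elim: t t' => B g IH [B' g'] tt.
case: s s' ss IH => [A f] [A' f'] ss IH /= [a|b].
  by have [a' ?] := ss a; exists (inl a').
by have [b' ?] := tt b; exists (inr b'); exact: IH.
Qed.

Lemma oadd_mono a a' b b' : ole a a' -> ole b b' -> ole (oadd a b) (oadd a' b').
Proof. by move=> ? ?; apply/ole_of/tadd_mono. Qed.

Lemma oadd_lel a b : ole a (oadd a b).
Proof. by rewrite -{1}(ord_reprK a); apply/ole_of/tadd_lel. Qed.

Lemma tlt_of s t : olt (ord_of s) (ord_of t) <-> tlt s t.
Proof. by rewrite (propext (oltNge _ _)) (propext (ole_of _ _)) (propext (tltP _ _)). Qed.

(* a + b is the least ordinal that is at least a and strictly above every
   a + c with c < b *)
Lemma oaddP a b c :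
  ole (oadd a b) c <-> ole a c /\ forall b', olt b' b -> olt (oadd a b') c.
Proof.
have addE : tle (tadd (ord_repr a) (ord_repr b)) (ord_repr c) <->
   tle (ord_repr a) (ord_repr c) /\
   forall t, tlt t (ord_repr b) -> tlt (tadd (ord_repr a) t) (ord_repr c).
  case Eb : (ord_repr b) => [B g]; move: (ord_repr a) (ord_repr c) => s u.
  split=> [H|[H1 H2]].
    split; first exact: tle_trans (tadd_lel _ _) H.
    move=> t [j tg].
    have {H} : forall j, tlt (tadd s (g j)) u.
      by case: s H => A f /tle_node H k; exact: (H (inr k)).
    move=> /(_ j)/tltP H; apply/tltP => us; apply: H.
    exact: tle_trans us (tadd_mono (tle_refl _) tg).
  case: s H1 H2 => A f H1 H2; apply/tle_node => -[i|j].
    by move/tle_node : H1.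
  by apply: H2; exists j; exact: tle_refl.
rewrite -(ord_reprK c) (propext (ole_of _ _)) (propext addE) -(propext (ole_of _ _)).
rewrite !ord_reprK; split=> -[H1 H2]; split=> // t.
  move=> /oltE /H2; rewrite -(propext (tlt_of _ _)).
  by rewrite ord_reprK.
move=> tb; have tE : teq (ord_repr (ord_of t)) t := ord_ofK t.
have /H2 : olt (ord_of t) b by rewrite -(ord_reprK b); apply/tlt_of.
move=> /oltE; have := ord_ofK (tadd (ord_repr a) (ord_repr (ord_of t))).
move=> [q1 q2] /tltP H; apply/tltP => h; apply: H.
apply: (tle_trans h); apply: tle_trans q2; apply: tadd_mono (tle_refl _) _.
exact: tE.2.
Qed.

Lemma oaddo0 a : oadd a ozero = a.
Proof.
apply: ole_anti (oadd_lel _ _); apply/oaddP; split; first exact: ole_refl.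
by move=> b /oltNge; case; exact: ole0.
Qed.

Lemma oltSge a b : olt a (osucc b) <-> ole a b.
Proof. by rewrite (propext (oltNge _ _)) (propext (osuccP _ _)) -(propext (oleNgt _ _)). Qed.

Lemma oadd_lt a b b' : olt b b' -> olt (oadd a b) (oadd a b').
Proof. by have /oaddP[_] := ole_refl (oadd a b'); apply. Qed.

Lemma oaddoS a b : oadd a (osucc b) = osucc (oadd a b).
Proof.
apply: ole_anti; last exact/osuccP/oadd_lt/olt_succ.
apply/oaddP; split.
  by apply: ole_trans (oadd_lel a b) _; apply/olt_ole/olt_succ.
by move=> c /oltSge cb; apply/oltSge/oadd_mono => //; exact: ole_refl.
Qed.

Lemma oadd_lim a b c : olimit b ->
  ole (oadd a b) c <-> forall b', olt b' b -> ole (oadd a b') c.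
Proof.
move=> [b0 bS]; split=> [/oaddP[_ H] b' /H/olt_ole//|H].
have b0' : olt ozero b by split; [exact: ole0|exact/nesym].
apply/oaddP; split; first by rewrite -(oaddo0 a); exact: H.
move=> b' /osuccP bb'; have lt : olt (osucc b') b by split => // /esym/bS.
by apply: olt_le_trans (H _ lt); apply/oadd_lt/olt_succ.
Qed.

(* [Some a] is the ordinal [a] and [None] is the symbol oo *)
Definition eord := option ord.

Definition eole (x y : eord) : Prop :=
  match x, y with
  | _, None => True
  | None, Some _ => False
  | Some a, Some b => ole a b
  end.

(* the least ordinal satisfying [P], or oo if there is none *)
Definition oleast (P : ord -> Prop) : eord :=
  match pselect (exists a, P a /\ forall b, P b -> ole a b) with
  | left h => Some (projT1 (cid h))
  | right _ => None
  end.

Lemma oleast_SomeP P a :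
  oleast P = Some a <-> P a /\ forall b, P b -> ole a b.
Proof.
rewrite /oleast; case: pselect => [h|n]; last by split=> // H; case: n; exists a.
case: (cid h) => c /= [Pc cP]; split=> [[<-]//|[Pa aP]].
by congr Some; apply: ole_anti; [exact: cP|exact: aP].
Qed.

Lemma oleast_NoneP P : oleast P = None <-> forall a, ~ P a.
Proof.
split=> [E a|n]; last first.
  by case E : (oleast P) => [a|//]; have /oleast_SomeP[/n] := E.
elim: (olt_wf a) => {}a _ IH Pa.
have /oleast_SomeP : P a /\ forall b, P b -> ole a b.
  by split=> // b Pb; apply/oleNgt => /IH; exact.
by rewrite E.
Qed.

Definition gamma_number (g : ord) : Prop :=
  forall a b, olt a g -> olt b g -> olt (oadd a b) g.

Definition Gamma (x : eord) : eord :=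
  match x with
  | Some a => oleast (fun g => gamma_number g /\ ole a g)
  | None => None
  end.

Lemma Gamma_finite a : exists g, Gamma (Some a) = Some g.
Proof.
case E : (Gamma (Some a)) => [g|]; first by exists g.
pose u := fix u n := if n is m.+1 then oadd (u m) (u m) else osucc a.
have u0 n : olt a (u n).
  elim: n => [|n IH]; first exact: olt_succ.
  exact: olt_le_trans IH (oadd_lel _ _).
have uS n : olt (u n) (u n.+1).
  rewrite -[X in olt X _]oaddo0; apply: oadd_lt.
  by apply: ole_lt_trans (u0 n); exact: ole0.
have umono m n : (m <= n)%N -> ole (u m) (u n).
  elim: n => [|n IH]; first by rewrite leqn0 => /eqP ->; exact: ole_refl.
  rewrite leq_eqVlt => /predU1P[->|/IH h]; first exact: ole_refl.
  exact: ole_trans h (olt_ole (uS n)).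
have uab n : olt (u n) (oabove u) by have /oaboveP := ole_refl (oabove u).
have ltu b : olt b (oabove u) -> exists n, ole b (u n).
  move=> /oltNge h; apply: contrapT => /forallNP H; apply: h.
  by apply/oaboveP => n; apply/oltNge.
have /oleast_NoneP/(_ (oabove u)) := E; case; split.
  move=> b c /ltu[n bn] /ltu[m cm].
  apply: ole_lt_trans (uab (maxn n m).+1) => /=.
  by apply: oadd_mono; [apply: ole_trans bn _|apply: ole_trans cm _];
    apply: umono; rewrite ?leq_maxl ?leq_maxr.
by apply: ole_trans (olt_ole (uab 0%N)); exact: olt_ole (u0 0%N).
Qed.

Section derived.
Variables (T : Type) (d : set T -> set T) (K : set T).

(* [K] at 0, [d] of the previous stage at successors, and the intersection of
   the previous stages at limits (see [derived0], [derivedS], [derived_lim]) *)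
Definition derived_step (a : ord) (D : forall b, olt b a -> set T) : set T :=
  if pselect (a = ozero) is left _ then K else
  match pselect (exists b, a = osucc b) with
  | left h => d (D (projT1 (cid h))
      (eq_ind_r (olt (projT1 (cid h))) (olt_succ _) (projT2 (cid h))))
  | right _ => [set x | forall b (ba : olt b a), D b ba x]
  end.

Definition derived : ord -> set T := Fix olt_wf (fun=> set T) derived_step.

Lemma derivedE a : derived a = derived_step (fun b (_ : olt b a) => derived b).
Proof.
rewrite /derived Fix_eq// => b D D' DD'; congr derived_step.
by apply: functional_extensionality_dep => c;
  apply: functional_extensionality_dep => cb; exact: DD'.
Qed.

Lemma derived0 : derived ozero = K.
Proof. by rewrite derivedE /derived_step; case: pselect. Qed.

Lemma derivedS a : derived (osucc a) = d (derived a).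
Proof.
rewrite derivedE /derived_step; case: pselect => [/osucc_neq0//|_].
case: pselect => [h|[]]; last by exists a.
by case: (cid h) => b /= /osucc_inj ->.
Qed.

Lemma derived_lim a : olimit a ->
  derived a = [set x | forall b, olt b a -> derived b x].
Proof.
move=> [a0 aS]; rewrite derivedE /derived_step.
by case: pselect => // _; case: pselect => [[b /aS]//|_].
Qed.

Hypothesis dK : forall A, d A `<=` A.

Lemma derived_le a b : ole a b -> derived b `<=` derived a.
Proof.
elim: (olt_wf b) a => {}b _ IH a ab.
have [->//|neq] := pselect (a = b).
have [b0|b0] := pselect (b = ozero).
  by case: neq; rewrite b0; apply: ole_anti (ole0 _); rewrite -b0.
have lt : olt a b by [].
have [[c bc]|nS] := pselect (exists c, b = osucc c).
  rewrite bc derivedS; apply: subset_trans (@dK _) _.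
  by apply: IH; [rewrite bc; exact: olt_succ|apply/oltSge; rewrite -bc].
rewrite derived_lim; first by move=> x; exact.
by split=> // c bc; apply: nS; exists c.
Qed.

(* if no [derived a] is empty, this is because the iteration becomes stationary
   at a nonempty set, not for lack of ordinals *)
Lemma derived_stationary : exists a, derived (osucc a) = derived a.
Proof.
apply: contrapT => /forallNP H.
have ninj a b : olt a b -> derived a <> derived b.
  move=> ab E; apply: (H a); apply/seteqP; split.
    by apply: derived_le; exact/olt_ole/olt_succ.
  by rewrite E; apply: derived_le; exact/osuccP.
have inj a b : derived a = derived b -> a = b.
  move=> E; apply: ole_anti; apply/oleNgt => /ninj; last by [].
  by apply.
pose g (A : T -> Prop) : ord :=
  if pselect (exists a, derived a = A) is left h then projT1 (cid h) else ozero.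
have gK a : g (derived a) = a.
  rewrite /g; case: pselect => [h|[]]; last by exists a.
  by case: (cid h) => b /= /inj.
have /oaboveP/(_ (derived (oabove g))) := ole_refl (oabove g).
by rewrite gK => /olt_irr.
Qed.

End derived.

Section dual.
Variables (k : numFieldType) (X : normedModType k).

Definition dual_pred : {pred X -> k^o} :=
  [pred f | `[< linear f /\ continuous f >]].

Lemma dual_submod_closed : submod_closed dual_pred.
Proof.
split=> [|a f g /asboolP[lf cf] /asboolP[lg cg]]; apply/asboolP; split.
- move=> b x y; change (0 = b *: (0 : k^o) + 0 :> k^o).
  by rewrite scaler0 addr0.
- exact: cst_continuous.
- move=> b x y; rewrite !fctE lf lg !scalerDr !scalerA [a * b]mulrC -!addrA.
  by congr (_ + _); rewrite addrCA.
- by move=> x; apply: cvgD (cg x); apply: cvgZr; exact: cf.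
Qed.

HB.instance Definition _ :=
  GRing.isSubmodClosed.Build k (X -> k^o) dual_pred dual_submod_closed.

Record dual : Type := Dual {
  dual_val :> X -> k^o;
  dual_valP : dual_val \in dual_pred }.

HB.instance Definition _ := [isSub for dual_val].
HB.instance Definition _ := [Choice of dual by <:].
HB.instance Definition _ := [SubChoice_isSubLmodule of dual by <:].

(* the topology of pointwise convergence on [X] *)
Definition weak_star : Type :=
  initial_topology (dual_val : dual -> {ptws X -> k^o}).

HB.instance Definition _ := Topological.on weak_star.

End dual.

Definition convex_hull (k : numDomainType) (M : lmodType k) (A : set M) : set M :=
  smallest (@convex_set k M) A.

Definition weak_star_closed_convex_hull (k : numFieldType) (X : normedModType k)
    (A : set (dual X)) : set (dual X) :=
  @closure (weak_star X) (convex_hull A).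

Variant scalar_kind : Type := RealScalars | ComplexScalars.

Definition scalars (R : realType) (s : scalar_kind) : numFieldType :=
  match s with RealScalars => R | ComplexScalars => R[i] end.

(* the absolute value of the numFieldType [R[i]] is [R[i]]-valued *)
Definition modulus (R : realType) (s : scalar_kind) : scalars R s -> R :=
  match s return scalars R s -> R with
  | RealScalars => fun x => `|x|
  | ComplexScalars => fun z => complex.Re `|z|
  end.

Section szlenk.
Variables (R : realType) (s : scalar_kind) (X : normedModType (scalars R s)).
Implicit Types (f : dual X) (A K : set (dual X)) (e : R).

Definition dual_norm f : \bar R :=
  ereal_sup [set (modulus (f x))%:E | x in [set x : X | `|x| <= 1]].

Definition norm_diam A : \bar R :=
  ereal_sup [set dual_norm (p.1 - p.2) | p in A `*` A].

Definition szlenk_derivation e K : set (dual X) :=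
  [set f | K f /\ forall V : set (weak_star X), nbhs (f : weak_star X) V ->
     (e%:E < norm_diam (V `&` K))%E].

Definition szlenk_derived e K : ord -> set (dual X) :=
  @derived (dual X) (szlenk_derivation e) K.

Definition szlenk_eps e K : eord :=
  oleast (fun a => szlenk_derived e K a = set0).

(* the supremum of the [szlenk_eps e K], [0 < e], is their least upper bound;
   it is oo when one of them is, because oo is below no ordinal *)
Definition szlenk K : eord :=
  oleast (fun a => forall e, 0 < e -> eole (szlenk_eps e K) (Some a)).

End szlenk.

(* Main.v *)
Require Import Defs.
From mathcomp Require Import all_boot all_order all_algebra.
From mathcomp Require Import complex.
From mathcomp Require Import all_classical all_reals all_analysis.
From mathcomp Require Import ring.

(* Write [L] for the closed convex hull of [K]. As [K] is contained in [L], and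
   the midpoint maps carry the derived sets of [L] of order [a] and [b] into its
   derived set of order [a + b] (for half the radius), Sz(L) is a gamma number
   not below Sz(K). Conversely it must be shown, by induction on the gamma number
   [g], that the derived sets of order [g] of [L] vanish as soon as those of [K]
   do.

   The Szlenk derivation is first replaced by the equivalent one that removes the
   relatively open subsets covered by finitely many norm balls of radius [e]: it
   commutes with finite unions and preserves closed sets. If [g] is a limit, then
   by compactness the derived set of [K] of order [b * n] is empty for some gamma
   number [b < g] and some integer [n]. Let [K_j] be the derived set of order
   [b * j], and let [M_r] be the closure of the set of barycenters of finitely
   supported probability measures on the disjoint union of the [K_j] along which
   [j] has mean at least [r]. Then [M_0 = L], and [M_r] is empty for [r > n].
   Given [x] outside [M_(r + c)], choose a small basic weak* neighborhood [W] of 0.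
   A measure whose barycenter is in [M_r], close to [x], puts mass less than [c] on
   the points of [K_j] close (up to [W]) to [K_(j+1)], since transporting this mass
   one level up would produce a point of [M_(r + c)] close to [x]. So near [x],
   [M_r] is contained in [(1 - c) co(G) + c L], where [G] is the union of the sets
   [K_j \ (K_(j+1) + W)], whose derived set of order [b] is empty. By the induction
   hypothesis the derived set of order [b] of [co(G)] is empty, and for small [c]
   this survives the norm perturbation [c L]. Hence deriving [M_r] [b] times leads
   into [M_(r + c)], and finitely many such steps exhaust [L]. *)

Set Implicit Arguments.
Unset Strict Implicit.
Unset Printing Implicit Defensive.
Import Order.TTheory GRing.Theory Num.Theory.
Import numFieldNormedType.Exports.

Local Open Scope classical_set_scope.
Local Open Scope ring_scope.

(** * Ordinals and iterated derivations *)

Lemma ord_ind (P : ord -> Prop) :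
  P ozero -> (forall a, P a -> P (osucc a)) ->
  (forall a, olimit a -> (forall b, olt b a -> P b) -> P a) -> forall a, P a.
Proof.
move=> P0 PS Pl a; elim: (olt_wf a) => {}a _ IH.
have [->//|a0] := pselect (a = ozero).
have [[b E]|nS] := pselect (exists b, a = osucc b).
  by rewrite E; apply/PS/IH; rewrite E; exact: olt_succ.
by apply: Pl => //; split=> // b E; apply: nS; exists b.
Qed.

Lemma olimit_gt0 a : olimit a -> olt ozero a.
Proof. by move=> [a0 _]; split; [exact: ole0|exact/nesym]. Qed.

Lemma olt0 a : ~ olt a ozero.
Proof. by move=> /oltNge; apply; exact: ole0. Qed.

Lemma ole_lt b c : (forall b', olt b' b -> olt b' c) -> ole b c.
Proof. by move=> H; apply/oleNgt => /H/olt_irr. Qed.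

Lemma oadd_ler a b : ole b (oadd a b).
Proof.
elim: (olt_wf b) => {}b _ IH; apply: ole_lt => b' b'b.
exact: ole_lt_trans (IH _ b'b) (oadd_lt a b'b).
Qed.

Lemma olimit_add a b : olimit b -> olimit (oadd a b).
Proof.
move=> bl; split=> [E|c E].
  apply: (@olt0 a); rewrite -E -{1}(oaddo0 a).
  exact/oadd_lt/olimit_gt0.
have /oltNge := olt_succ c; rewrite -E; apply.
apply/(oadd_lim _ _ bl) => b' b'b; apply/oltSge; rewrite -E.
exact: oadd_lt.
Qed.

Lemma olt_add_lim a b c : olimit b -> olt c (oadd a b) ->
  exists2 b', olt b' b & olt c (oadd a b').
Proof.
move=> bl /oltNge h; apply: contrapT => H; apply: h.
by apply/(oadd_lim _ _ bl) => b' b'b; apply/oleNgt => h; apply: H; exists b'.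
Qed.

Lemma oaddA a b c : oadd a (oadd b c) = oadd (oadd a b) c.
Proof.
elim/ord_ind: c => [|c IH|c cl IH]; first by rewrite !oaddo0.
  by rewrite !oaddoS IH.
apply: ole_anti; last first.
  apply/(oadd_lim _ _ cl) => c' /[dup] c'c /IH <-.
  exact/olt_ole/oadd_lt/oadd_lt.
apply/(oadd_lim _ _ (olimit_add b cl)) => d /(olt_add_lim cl)[c' c'c dc'].
apply: ole_trans (olt_ole (oadd_lt _ c'c)).
by rewrite -IH //; exact/olt_ole/oadd_lt.
Qed.

Fixpoint omuln (b : ord) (n : nat) : ord :=
  if n is m.+1 then oadd (omuln b m) b else ozero.

Lemma omuln0l n : omuln ozero n = ozero.
Proof. by elim: n => //= n ->; rewrite oaddo0. Qed.

Lemma omuln_mono a b n : ole a b -> ole (omuln a n) (omuln b n).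
Proof.
by move=> ab; elim: n => [|n IH] /=; [exact: ole_refl|exact: oadd_mono].
Qed.

Lemma omuln_double b n : omuln (oadd b b) n = omuln b n.*2.
Proof. by elim: n => //= n ->; rewrite -oaddA. Qed.

Lemma oleast_ex (P : ord -> Prop) a : P a -> exists b, oleast P = Some b.
Proof.
move=> Pa; case E : (oleast P) => [b|]; first by exists b.
by have /oleast_NoneP/(_ a) := E.
Qed.

Lemma omuln_lt_gamma g b n : olt ozero g -> gamma_number g -> olt b g ->
  olt (omuln b n) g.
Proof. by move=> g0 gg bg; elim: n => [//|n IH]; exact: gg. Qed.

(* The least [b] with [eta <= b * n] for some [n] is the leading power of omega
   in the Cantor normal form of [eta]. *)
Lemma leading_gamma eta : olt ozero eta -> exists b n,
  [/\ olt ozero b, gamma_number b, ole b eta & ole eta (omuln b n)].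
Proof.
move=> eta0; pose P b := exists n, ole eta (omuln b n).
have Peta : P eta by exists 1%N; exact: oadd_ler.
have [b /oleast_SomeP[[n bn] bmin]] := oleast_ex Peta.
exists b, n; split; [|move=> c d cb db|exact: bmin|by []].
  apply/oltNge => b0; apply/olt_irr/(olt_le_trans eta0).
  by rewrite -(omuln0l n); apply: ole_trans bn (omuln_mono _ b0).
apply/oltNge => bcd.
(* If [b <= c + d], the larger [m] of [c] and [d] satisfies [eta <= (m + m) * n = m * 2n], against
   the minimality of [b]. *)
have [m [mb mc md]] : exists m, [/\ olt m b, ole c m & ole d m].
  have [cd|dc] := ole_total c d; first by exists d; split=> //; exact: ole_refl.
  by exists c; split=> //; exact: ole_refl.
have /oltNge := mb; apply; apply: bmin; exists n.*2.
rewrite -omuln_double; apply: ole_trans bn (omuln_mono _ _).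
exact/(ole_trans bcd)/oadd_mono.
Qed.

(** A successor [b + 1] with [b > 0] is the sum of the smaller ordinals [b] and [1]. *)
Lemma gamma_cases g : gamma_number g ->
  [\/ g = ozero, g = osucc ozero | olimit g].
Proof.
move=> gg; elim/ord_ind: g gg => [|b _ gg|g]; [by constructor|constructor 2|by constructor].
congr osucc; apply: contrapT => b0.
have b_gt0 : olt ozero b by split; [exact: ole0|exact/nesym].
have /oltNge := gg _ _ (olt_succ b) (ole_lt_trans (proj2 (osuccP _ _) b_gt0) (olt_succ b)).
by rewrite oaddoS oaddo0; apply; exact: ole_refl.
Qed.

Section derived_theory.
Implicit Types T : Type.

(** Compares two iterations along a relation. It is applied with [rho] the equality, the equality on
    an open set, and the graph of a midpoint map. *)
Lemma derived_rel T T' (rho : T -> T' -> Prop) (d : set T -> set T)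
    (d' : set T' -> set T') A B th :
  (forall S S', (forall x y, rho x y -> S x -> S' y) ->
    forall x y, rho x y -> d S x -> d' S' y) ->
  (forall x y, rho x y -> A x -> B y) ->
  forall x y, rho x y -> derived d A th x -> derived d' B th y.
Proof.
move=> dd' AB; elim/ord_ind: th => [|th IH|th thl IH].
- by rewrite !derived0.
- by rewrite !derivedS; exact: dd'.
- move=> x y xy; rewrite !derived_lim// => H b bth.
  by apply: IH xy (H _ bth).
Qed.

Variables (T : Type) (d : set T -> set T).
Hypothesis dK : forall A, d A `<=` A.

Lemma derived_add A a b : derived d A (oadd a b) = derived d (derived d A a) b.
Proof.
elim/ord_ind: b => [|b IH|b bl IH].
- by rewrite oaddo0 derived0.
- by rewrite oaddoS !derivedS IH.
rewrite (derived_lim _ _ bl) (derived_lim _ _ (olimit_add a bl)).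
apply/seteqP; split=> x H c.
  by move=> cb; rewrite -IH //; apply/H/oadd_lt.
move=> /(olt_add_lim bl)[b' b'b cb']; have := H _ b'b; rewrite -IH //.
by apply: derived_le => //; exact: olt_ole.
Qed.

Lemma derived_empty A a b : ole a b -> derived d A a = set0 -> derived d A b = set0.
Proof. by move=> ab a0; rewrite -subset0 -a0; exact: derived_le. Qed.

End derived_theory.

(** * The weak* topology *)

(** Compactness as an induction principle. If [P A] failed, the sets [S] with [P] true of [A] minus
    [S] would form a proper filter containing [A], and the local hypothesis excludes every cluster
    point in [A]. *)
Lemma compact_local (T : topologicalType) (A : set T) (P : set T -> Prop) :
  compact A -> (forall S S', S `<=` S' -> P S' -> P S) -> P set0 ->
  (forall S S', P S -> P S' -> P (S `|` S')) ->
  (forall x, A x -> exists2 N, nbhs x N & P (A `&` N)) -> P A.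
Proof.
move=> cA Psub P0 PU Ploc; apply: contrapT => nPA.
pose F : set_system T := [set S | P (A `\` S)].
have FF : ProperFilter F.
  split; first by rewrite /F /= setD0.
  split=> [|S S' PS PS'|S S' SS' PS]; rewrite /F /=.
  - by rewrite setDT.
  - by rewrite setDIr; exact: PU.
  - by apply: Psub PS => x [Ax nS]; split=> // /SS'.
have FA : F A by rewrite /F /= setDv.
have [x [Ax clx]] := cA F FF FA.
have [N Nx PN] := Ploc x Ax.
have FN : F (~` N) by rewrite /F /= setDE setCK.
by have [y [nNy Ny]] := clx _ _ FN Nx.
Qed.

Section weak_star_topology.
Variables (k : numFieldType) (X : normedModType k).
Implicit Types (f g : dual X) (x : X) (A : set (dual X)).

Lemma dual_linear f : linear f.
Proof. by have /asboolP[] := dual_valP f. Qed.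

Lemma dual_continuous f : continuous f.
Proof. by have /asboolP[] := dual_valP f. Qed.

Lemma dual_ext f g : (forall x, f x = g x) -> f = g.
Proof. by move=> fg; apply: val_inj; apply/funext. Qed.

Lemma dualDE f g x : (f + g) x = f x + g x. Proof. by []. Qed.
Lemma dualNE f x : (- f) x = - f x. Proof. by []. Qed.
Lemma dualZE (a : k) f x : (a *: f) x = a * f x. Proof. by []. Qed.
Lemma dual0E x : (0 : dual X) x = 0. Proof. by []. Qed.

Lemma dual_appD f x y : f (x + y) = f x + f y.
Proof. by have := dual_linear f 1 x y; rewrite !scale1r. Qed.

Lemma dual_appZ f (a : k) x : f (a *: x) = a * f x.
Proof.
have f0 : f 0 = 0.
  by have := dual_appD f 0 0; rewrite addr0 -{1}[f 0]addr0 => /addrI.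
by have := dual_linear f a x 0; rewrite !addr0 f0 addr0.
Qed.

Lemma dual_eval_continuous x : continuous (fun f : weak_star X => (f : dual X) x : k^o).
Proof.
move=> f; have := @initial_continuous (dual X) {ptws X -> k^o} (@dual_val k X) f.
have FF : Filter ((@dual_val k X : weak_star X -> {ptws X -> k^o}) @ nbhs (f : weak_star X)).
  exact: fmap_filter.
by move=> /(@pointwise_cvgP X k^o _ (dual_val f) FF)/(_ x).
Qed.

Lemma weak_star_cvg (F : set_system (weak_star X)) f : Filter F ->
  (forall x, (fun g : weak_star X => (g : dual X) x : k^o) @ F --> (f x : k^o)) ->
  F --> (f : weak_star X).
Proof.
move=> FF H; have FF' : Filter ((@dual_val k X : weak_star X -> {ptws X -> k^o}) @ F).
  exact: fmap_filter.
have /(@pointwise_cvgP X k^o _ (dual_val f) FF') HH := H.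
move=> V; rewrite nbhsE => -[B [[C oC CB] fB] BV].
have : nbhs (dual_val f : {ptws X -> k^o}) C.
  by apply: open_nbhs_nbhs; split=> //; move: fB; rewrite -CB.
move=> /HH FC; apply: (@filterS _ F FF _ _ _ FC) => g Cg.
by apply: BV; rewrite -CB; exact: Cg.
Qed.

Definition wclose (xs : seq X) (r : k) f g :=
  forall x, x \in xs -> `|g x - f x| < r.

Lemma wclose_nbhs xs r f : 0 < r -> nbhs (f : weak_star X) (wclose xs r f).
Proof.
move=> r0; elim: xs => [|x xs IH].
  rewrite (_ : wclose _ _ _ = setT); first exact: (@filterT _ (nbhs (f : weak_star X))).
  by apply/seteqP; split=> // g _ y; rewrite in_nil.
have /cvgr_dist_lt/(_ r r0) Hx := @dual_eval_continuous x f.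
near=> g => y; rewrite in_cons => /predU1P[->|yxs].
  by rewrite distrC; near: g.
suff : wclose xs r f g by apply.
by near: g.
Unshelve. all: by end_near. Qed.

(** The sets containing some [wclose xs r f] form a filter that converges to [f] pointwise, hence in
    the weak* topology. *)
Lemma nbhs_wclose f (V : set (weak_star X)) : nbhs (f : weak_star X) V ->
  exists xs r, 0 < r /\ forall g, wclose xs r f g -> V g.
Proof.
pose F : set_system (weak_star X) :=
  [set V | exists xs r, 0 < r /\ forall g, wclose xs r f g -> V g].
have FF : Filter F.
  split.
  - by exists [::], 1.
  - move=> P Q [xs [r [r0 H]]] [ys [r' [r'0 H']]].
    have rr : r >=< r' by apply: real_comparable; exact: gtr0_real.
    exists (xs ++ ys), (Num.min r r'); split; first by rewrite comparable_lt_min // r0.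
    move=> g Hg; split; [apply: H|apply: H'] => x xs'.
      have := Hg x; rewrite mem_cat xs' comparable_lt_min // => /(_ isT).
      by case/andP.
    have := Hg x; rewrite mem_cat xs' orbT comparable_lt_min // => /(_ isT).
    by case/andP.
  - by move=> P Q PQ [xs [r [r0 H]]]; exists xs, r; split=> // g /H/PQ.
suff : F --> (f : weak_star X) by move=> /[apply].
apply: weak_star_cvg => x; apply/(@cvgrPdist_lt _ k^o) => e e0.
exists [:: x], e; split=> // g /(_ x); rewrite mem_head => /(_ isT).
by rewrite /= distrC.
Qed.

Lemma wclose_open xs r f : open (wclose xs r f : set (weak_star X)).
Proof.
elim: xs => [|x xs IH].
  rewrite (_ : wclose _ _ _ = setT); first exact: openT.
  by apply/seteqP; split=> // g _ y; rewrite in_nil.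
rewrite (_ : wclose _ _ _ = wclose xs r f `&`
  ((fun g : weak_star X => (g : dual X) x : k^o) @^-1` [set z | `|z - f x| < r])).
  apply: openI => //; apply: open_comp; first by move=> g _; exact: dual_eval_continuous.
  rewrite (_ : [set z | _] = ball (f x : k^o) r); first exact: ball_open.
  by apply/seteqP; split=> z; rewrite -ball_normE /= distrC.
apply/seteqP; split=> g H.
  split=> [y yxs|]; first by apply: H; rewrite in_cons yxs orbT.
  by apply: H; rewrite mem_head.
by move=> y; rewrite in_cons => /predU1P[->|]; [exact: H.2|exact: H.1].
Qed.

Lemma weak_star_closedP A :
  (forall f, (forall xs r, 0 < r -> exists2 g, A g & wclose xs r f g) -> A f) ->
  closed (A : set (weak_star X)).
Proof.
move=> H f clf; apply: H => xs r r0.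
by have [g [Ag fg]] := clf _ (wclose_nbhs xs f r0); exists g.
Qed.

Lemma closure_wclose A f : closure (A : set (weak_star X)) f ->
  forall xs r, 0 < r -> exists2 g, A g & wclose xs r f g.
Proof.
by move=> clf xs r r0; have [g [Ag fg]] := clf _ (wclose_nbhs xs f r0); exists g.
Qed.

Lemma weak_star_hausdorff : hausdorff_space (weak_star X).
Proof.
move=> f g fg; apply: dual_ext => x.
apply: (@norm_hausdorff _ k^o) => U V Uf Vg.
have Uf' := dual_eval_continuous Uf; have Vg' := dual_eval_continuous Vg.
by have [h [? ?]] := fg _ _ Uf' Vg'; exists (h x).
Qed.

Lemma weak_star_separated f g : f <> g -> exists U V : set (weak_star X),
  [/\ nbhs (f : weak_star X) U, nbhs (g : weak_star X) V & U `&` V = set0].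
Proof.
move=> fg; apply: contrapT => H; apply/fg/weak_star_hausdorff => U V Uf Vg.
by apply: contrapT => /set0P/negP/negPn/eqP UV; apply: H; exists U, V.
Qed.

(* Radii are scalars, because the norm of [X] is scalar-valued; [e : R] only
   enters through [scalar_of] below. *)
Definition dnorm_le f (e : k) := forall x, `|f x| <= e * `|x|.

Lemma dnorm_le_sym f g e : dnorm_le (f - g) e -> dnorm_le (g - f) e.
Proof. by move=> H x; have := H x; rewrite !dualDE !dualNE distrC. Qed.

Lemma dnorm_le_trans g f h e e' :
  dnorm_le (f - g) e -> dnorm_le (g - h) e' -> dnorm_le (f - h) (e + e').
Proof.
move=> H H' x; rewrite mulrDl; apply: le_trans (lerD (H x) (H' x)).
by rewrite !dualDE !dualNE -[f x - h x](subrKA (g x)) ler_normD.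
Qed.

Lemma dnorm_le_closed g e : 0 <= e ->
  closed ([set f | dnorm_le (f - g) e] : set (weak_star X)).
Proof.
move=> e0; apply: weak_star_closedP => f H x; rewrite dualDE dualNE.
rewrite real_leNgt ?ger0_real ?mulr_ge0//.
apply/negP => lt; have d0 : 0 < `|f x - g x| - e * `|x| by rewrite subr_gt0.
have [h hg /(_ x)] := H [:: x] _ d0; rewrite mem_head => /(_ isT).
apply/negP; rewrite -real_leNgt ?realB ?ger0_real ?mulr_ge0//.
rewrite lerBlDr -[f x - g x](subrKA (h x)) distrC.
apply: le_trans (lerD (lexx _) (hg x)); rewrite dualDE dualNE distrC addrC.
apply: le_trans (ler_normD _ _) _.
by rewrite addrC [X in X + _]distrC.
Qed.

End weak_star_topology.

(** * The ball derivation *)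

Section dnorm_le_theory.
Variables (k : numFieldType) (X : normedModType k).
Implicit Types (f g : dual X).

Lemma dnorm_leD f g e e' : dnorm_le f e -> dnorm_le g e' -> dnorm_le (f + g) (e + e').
Proof.
by move=> H H' x; rewrite mulrDl; apply: le_trans (ler_normD _ _) (lerD (H x) (H' x)).
Qed.

Lemma dnorm_leZ (c : k) f e : 0 <= c -> dnorm_le f e -> dnorm_le (c *: f) (c * e).
Proof.
by move=> c0 H x; rewrite dualZE normrM (ger0_norm c0) -mulrA; apply: ler_wpM2l.
Qed.

Lemma dnorm_le_le f e e' : e <= e' -> dnorm_le f e -> dnorm_le f e'.
Proof. by move=> ee H x; apply: le_trans (H x) (ler_wpM2r _ ee). Qed.

Lemma dnorm_le0 e : 0 <= e -> dnorm_le (0 : dual X) e.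
Proof. by move=> e0 x; rewrite dual0E normr0 mulr_ge0. Qed.

End dnorm_le_theory.

Section ball_derivation_theory.
Variables (k : numFieldType) (X : normedModType k).
Implicit Types (f g : dual X) (S A B : set (dual X)) (e : k).

Lemma weak_star_compact_closed A :
  compact (A : set (weak_star X)) -> closed (A : set (weak_star X)).
Proof. exact: (compact_closed (@weak_star_hausdorff k X)). Qed.

(** The centers need not lie in [S], so that coverings restrict to subsets. *)
Definition ball_cover e S :=
  exists P : seq (dual X), forall f, S f -> exists2 p, p \in P & dnorm_le (f - p) e.

Lemma ball_cover0 e : ball_cover e set0. Proof. by exists [::]. Qed.

Lemma ball_coverS e S S' : S `<=` S' -> ball_cover e S' -> ball_cover e S.
Proof. by move=> SS [P H]; exists P => f /SS/H. Qed.

Lemma ball_coverU e S S' : ball_cover e S -> ball_cover e S' -> ball_cover e (S `|` S').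
Proof.
move=> [P H] [P' H']; exists (P ++ P') => f [/H|/H'] [p pP fp];
  by exists p => //; rewrite mem_cat pP ?orbT.
Qed.

Lemma ball_cover_le e e' S : e <= e' -> ball_cover e S -> ball_cover e' S.
Proof.
by move=> ee [P H]; exists P => f /H[p pP fp]; exists p => //; exact: dnorm_le_le fp.
Qed.

Definition ball_derivation e A : set (dual X) :=
  [set f | A f /\ forall V, nbhs (f : weak_star X) V -> ~ ball_cover e (V `&` A)].

Lemma ball_derivationK e A : ball_derivation e A `<=` A. Proof. by move=> f []. Qed.

Lemma ball_derivationN e A f : A f -> ~ ball_derivation e A f ->
  exists2 V, nbhs (f : weak_star X) V & ball_cover e (V `&` A).
Proof.
move=> Af H; apply: contrapT => HV; apply: H; split=> // V fV bV.
by apply: HV; exists V.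
Qed.

Lemma ball_derivation_mono e e' A B : e' <= e -> A `<=` B ->
  ball_derivation e A `<=` ball_derivation e' B.
Proof.
move=> ee AB f [Af H]; split=> [|V Vf bV]; first exact: AB.
apply: (H V Vf); apply: ball_cover_le ee _; apply: ball_coverS bV.
by move=> g [Vg Ag]; split=> //; exact: AB.
Qed.

Lemma ball_derivation_closed e A : closed (A : set (weak_star X)) ->
  closed (ball_derivation e A : set (weak_star X)).
Proof.
move=> cA f clf; split=> [|V Vf bV].
  by apply: cA; move: clf; apply: closureS; exact: ball_derivationK.
have [g [[Ag gH] Vg]] := clf _ (nbhs_interior Vf).
exact: gH bV.
Qed.

(** Concatenating two lists of centers keeps the radius, whereas a union of two sets of small
    diameter may have a large diameter. Closedness handles a point outside one of the sets: the
    complement is then a neighborhood of it. *)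
Lemma ball_derivationU e A B :
 
  closed (A : set (weak_star X)) -> closed (B : set (weak_star X)) ->
  ball_derivation e (A `|` B) `<=` ball_derivation e A `|` ball_derivation e B.
Proof.
have H A' f : closed (A' : set (weak_star X)) -> ~ ball_derivation e A' f ->
    exists2 V, nbhs (f : weak_star X) V & ball_cover e (V `&` A').
  move=> cA; have [A'f|nA'f] := pselect (A' f); first exact: ball_derivationN.
  move=> _; exists (~` A'); first by apply: open_nbhs_nbhs; split=> //; exact: closed_openC.
  by rewrite setICl; exact: ball_cover0.
move=> cA cB f [ABf fH]; apply: contrapT => /not_orP[].
move=> /(H _ _ cA)[V Vf bV] /(H _ _ cB)[V' V'f bV'].
apply: (fH (V `&` V')); first exact: (@filterI _ (nbhs (f : weak_star X))).
by apply: ball_coverS (ball_coverU bV bV') => g [[? ?] [?|?]]; [left|right].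
Qed.

Definition ball_derived e A th := derived (ball_derivation e) A th.

Lemma ball_derived_sub e A th : ball_derived e A th `<=` A.
Proof.
by have := derived_le (K := A) (ball_derivationK (e := e)) (ole0 th); rewrite derived0.
Qed.

Lemma ball_derived_closed e A th : closed (A : set (weak_star X)) ->
  closed (ball_derived e A th : set (weak_star X)).
Proof.
move=> cA; rewrite /ball_derived; elim/ord_ind: th => [|th IH|th thl IH].
- by rewrite derived0.
- by rewrite derivedS; exact: ball_derivation_closed.
- rewrite derived_lim// => f clf b bth; apply: (IH b bth).
  by move: clf; apply: closureS => g; apply.
Qed.

Lemma ball_derived_compact e A th : compact (A : set (weak_star X)) ->
  compact (ball_derived e A th : set (weak_star X)).
Proof.
move=> cA.
have cl : closed (ball_derived e A th : set (weak_star X)).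
  by apply: ball_derived_closed; exact: weak_star_compact_closed.
exact: (subclosed_compact cl cA (@ball_derived_sub e A th)).
Qed.

Lemma ball_derived_mono e e' A B th : e' <= e -> A `<=` B ->
  ball_derived e A th `<=` ball_derived e' B th.
Proof.
move=> ee AB f Af.
apply: (derived_rel (rho := eq) (d := ball_derivation e) (A := A)) erefl Af.
  move=> S S' SS x _ <-; apply: ball_derivation_mono => // y; exact: (SS y y erefl).
by move=> x _ <- /AB.
Qed.

(** A point of the open set [V] can be tested on neighborhoods inside [V], where [A] and its trace
    on [V] agree. *)
Lemma ball_derived_local e A V th : open (V : set (weak_star X)) ->
  V `&` ball_derived e A th `<=` ball_derived e (V `&` A) th.
Proof.
move=> oV f [Vf Af].
apply: (derived_rel (rho := fun x y => x = y /\ V x) (d := ball_derivation e) (A := A)) Af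
  => //.
  move=> S S' SS x _ [<- Vx] [Sx H]; split=> [|W Wx bW]; first exact: SS.
  apply: (H (V `&` W)).
    apply: (@filterI _ (nbhs (x : weak_star X))) => //.
    by apply: open_nbhs_nbhs.
  by apply: ball_coverS bW => y [[Vy Wy] Sy]; split=> //; exact: SS.
by move=> x _ [<- Vx] Ax.
Qed.

Lemma ball_derivedU e A B th :
 
  closed (A : set (weak_star X)) -> closed (B : set (weak_star X)) ->
  ball_derived e (A `|` B) th `<=` ball_derived e A th `|` ball_derived e B th.
Proof.
move=> cA cB; rewrite /ball_derived; elim/ord_ind: th => [|th IH|th thl IH].
- by rewrite !derived0.
- rewrite !derivedS => f /(ball_derivation_mono (lexx e) IH).
  by apply: ball_derivationU; exact: ball_derived_closed.
- rewrite !derived_lim// => f H; apply: contrapT => /not_orP[].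
  move=> /existsNP[b /not_implyP[bth nb]] /existsNP[b' /not_implyP[b'th nb']].
  have mono C c c' : ole c c' ->
      derived (ball_derivation e) C c' `<=` derived (ball_derivation e) C c.
    by apply: derived_le; exact: ball_derivationK.
  have [bb|bb] := ole_total b b'.
    by have [|] := IH _ b'th _ (H _ b'th) => // /(mono _ _ _ bb).
  by have [|] := IH _ bth _ (H _ bth) => // /(mono _ _ _ bb).
Qed.

(** Stages are closed, so each point of [A] has a neighborhood missing some stage before [th]. As
    stages decrease, compactness yields a single stage missed by all of [A]. *)
Lemma ball_derived_lim_empty e A th : compact (A : set (weak_star X)) -> olimit th ->
  ball_derived e A th = set0 -> exists2 th', olt th' th & ball_derived e A th' = set0.
Proof.
move=> cA thl A0.
have cl : closed (A : set (weak_star X)).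
  exact: weak_star_compact_closed.
suff [b bth H] : exists2 b, olt b th & forall f, A f -> ~ ball_derived e A b f.
  by exists b => //; rewrite -subset0 => f /[dup] /ball_derived_sub /H.
apply: (@compact_local (weak_star X) A (fun S => exists2 b, olt b th &
   forall f, S f -> ~ ball_derived e A b f)) => //.
- by move=> S S' SS [b bth H]; exists b => // f /SS/H.
- by exists ozero; [exact: olimit_gt0|].
- move=> S S' [b bth H] [b' b'th H'].
  have mono c c' : ole c c' -> ball_derived e A c' `<=` ball_derived e A c.
    by apply: derived_le; exact: ball_derivationK.
  have [bb|bb] := ole_total b b'.
    by exists b' => // f [/H nb /(mono _ _ bb)|/H'].
  by exists b => // f [/H|/H' nb /(mono _ _ bb)].
- move=> f Af; have : ~ ball_derived e A th f by rewrite A0.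
  rewrite /ball_derived derived_lim// => /existsNP[b /not_implyP[bth nb]].
  exists (~` ball_derived e A b); last by exists b => // g [].
  by apply: open_nbhs_nbhs; split=> //; apply/closed_openC/ball_derived_closed.
Qed.

(* [mix c (A x B)] is a norm perturbation of [A] of size [c * diam B]. *)
Definition mix (c : k) (p : weak_star X * weak_star X) : weak_star X :=
  (1 - c) *: (p.1 : dual X) + c *: (p.2 : dual X).

Lemma mix_continuous c : continuous (mix c).
Proof.
move=> p; apply: weak_star_cvg => x.
change ((fun q : weak_star X * weak_star X => (1 - c) *: ((q.1 : dual X) x : k^o) +
  c *: ((q.2 : dual X) x : k^o)) @ nbhs p -->
  ((1 - c) *: ((p.1 : dual X) x : k^o) + c *: ((p.2 : dual X) x : k^o))).
apply: cvgD; apply: cvgZr.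
  exact: (@continuous_comp _ _ _ (@fst (weak_star X) (weak_star X))
    (fun f : weak_star X => (f : dual X) x : k^o) p cvg_fst (@dual_eval_continuous _ _ x _)).
exact: (@continuous_comp _ _ _ (@snd (weak_star X) (weak_star X))
  (fun f : weak_star X => (f : dual X) x : k^o) p cvg_snd (@dual_eval_continuous _ _ x _)).
Qed.

(** With [b0] fixed in [B], replacing the second component by [b0] costs at most [c * D], and the
    first component is covered at radius [(1 - c) * e' <= e']. *)
Lemma ball_cover_mix c e e' D S B : 0 <= c -> c <= 1 -> 0 <= e' -> e' + c * D <= e ->
  (forall f g, B f -> B g -> dnorm_le (f - g) D) ->
  ball_cover e' S -> ball_cover e (mix c @` (S `*` B)).
Proof.
move=> c0 c1 e'0 ee BD [P HP].
have [[b0 Bb0]|nB] := pselect (exists b, B b); last first.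
  by exists [::] => f [[a b] [_ /= Bb]]; case: nB; exists b.
exists [seq mix c (p, b0) | p <- P] => f [[a b] [/= /HP[p pP ap] Bb] <-].
exists (mix c (p, b0)); first exact: map_f.
apply: (@dnorm_le_le _ _ _ ((1 - c) * e' + c * D)).
  by apply: le_trans ee; rewrite lerD2r ler_piMl// lerBlDr lerDl.
rewrite /mix /= opprD addrACA -!scalerBr; apply: dnorm_leD.
  by apply: dnorm_leZ => //; rewrite subr_ge0.
by apply: dnorm_leZ => //; exact: BD.
Qed.

(** * Derived sets of norm perturbations *)

Section perturbation.
Variables (A B : set (dual X)) (c e e' D : k).
Hypotheses (cA : compact (A : set (weak_star X))) (cB : compact (B : set (weak_star X))).
Hypotheses (c0 : 0 <= c) (c1 : c <= 1) (e'0 : 0 <= e') (ee : e' + c * D <= e).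
Hypothesis BD : forall f g, B f -> B g -> dnorm_le (f - g) D.

(** Let [f] lie outside the right-hand side. Near a pair not mapped to [f], the images avoid a
    neighborhood of [f]; for a pair mapped to [f], the first component has a neighborhood whose
    trace on [A'] is covered. Compactness of [A' x B] combines the two cases. *)
Lemma ball_derivation_mix A' : compact (A' : set (weak_star X)) ->
  ball_derivation e (mix c @` (A' `*` B)) `<=` mix c @` (ball_derivation e' A' `*` B).
Proof.
move=> cA' f [_ fH]; apply: contrapT => nf.
pose P (S : set (weak_star X * weak_star X)) :=
  exists2 V, nbhs (f : weak_star X) V & ball_cover e (V `&` mix c @` S).
suff [V Vf bV] : P (A' `*` B) by exact: fH bV.
apply: (compact_local (compact_setX cA' cB)).
- move=> S S' SS [V Vf bV]; exists V => //; apply: ball_coverS bV.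
  by move=> g [Vg [p Sp pg]]; split=> //; exists p => //; exact: SS.
- exists setT; first exact: (@filterT _ (nbhs (f : weak_star X))).
  by rewrite image_set0 setI0; exact: ball_cover0.
- move=> S S' [V Vf bV] [V' V'f bV']; exists (V `&` V').
    exact: (@filterI _ (nbhs (f : weak_star X))).
  apply: ball_coverS (ball_coverU bV bV') => g [[Vg V'g] [p [Sp|Sp] pg]];
    by [left; split=> //; exists p|right; split=> //; exists p].
move=> [a b] [/= Aa Bb].
have [E|nE] := pselect (mix c (a, b) = f); last first.
  have [U1 [U2 [U1p U2f U12]]] := weak_star_separated nE.
  exists (mix c @^-1` U1); first exact: mix_continuous.
  exists U2 => //.
  apply: ball_coverS (ball_cover0 e) => g [U2g [p [_ U1p'] pg]].
  by rewrite -U12; split=> //; rewrite -pg.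
have [] := @ball_derivationN e' A' a Aa.
  by move=> sa; apply: nf; exists (a, b).
move=> N Na bN; exists (N `*` setT).
  by exists (N, setT) => //; split=> //; exact: (@filterT _ (nbhs (b : weak_star X))).
exists setT; first exact: (@filterT _ (nbhs (f : weak_star X))).
apply: ball_coverS (ball_cover_mix c0 c1 e'0 ee BD bN).
by move=> g [_ [p [[Ap Bp] [Np _]] pg]]; exists p => //; split.
Qed.

Lemma ball_derived_mix th :
  ball_derived e (mix c @` (A `*` B)) th `<=` mix c @` (ball_derived e' A th `*` B).
Proof.
have cl : closed (A : set (weak_star X)).
  exact: weak_star_compact_closed.
rewrite /ball_derived; elim/ord_ind: th => [|th IH|th thl IH].
- by rewrite !derived0.
- rewrite !derivedS => f /(ball_derivation_mono (lexx e) IH).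
  by apply: ball_derivation_mix; exact: ball_derived_compact.
(* At a limit, compactness of [A x B] gives one stage [b < th] at which no pair mapped to [f] still
   has its first component in the derived set of [A]. This contradicts the induction hypothesis at
   [b]. *)
rewrite [X in X `<=` _]derived_lim// => f H; apply: contrapT => nf.
have mono b b' : ole b b' ->
    derived (ball_derivation e') A b' `<=` derived (ball_derivation e') A b.
  by apply: derived_le; exact: ball_derivationK.
pose P (S : set (weak_star X * weak_star X)) :=
  exists2 b, olt b th & forall p, S p -> mix c p = f -> ~ ball_derived e' A b p.1.
suff [b bth bP] : P (A `*` B).
  have [p [/= pA pB] pf] := IH _ bth _ (H _ bth).
  by apply: bP (pf) (pA); split=> //; exact: ball_derived_sub pA.
apply: (compact_local (compact_setX cA cB)).
- by move=> S S' SS [b bth bP]; exists b => // p /SS/bP.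
- by exists ozero; [exact: olimit_gt0|].
- move=> S S' [b bth Hb] [b' b'th Hb'].
  have [bb|bb] := ole_total b b'.
    by exists b' => // p [/Hb nb /nb nb' /(mono _ _ bb)|/Hb'].
  by exists b => // p [/Hb|/Hb' nb /nb nb' /(mono _ _ bb)].
move=> [a b] [/= Aa Bb].
have [E|nE] := pselect (mix c (a, b) = f); last first.
  have [U1 [U2 [U1p U2f U12]]] := weak_star_separated nE.
  exists (mix c @^-1` U1); first exact: mix_continuous.
  exists ozero; first exact: olimit_gt0.
  move=> p [_ U1p'] pf _; suff : (U1 `&` U2) f by rewrite U12.
  by split; [rewrite -pf|exact: (@nbhs_singleton (weak_star X))].
have : ~ derived (ball_derivation e') A th a by move=> sa; apply: nf; exists (a, b).
rewrite derived_lim// => /existsNP[t /not_implyP[tth nt]].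
exists ((~` ball_derived e' A t) `*` setT).
  exists (~` ball_derived e' A t, setT) => //; split=> /=.
    by apply: open_nbhs_nbhs; split=> //; apply/closed_openC/ball_derived_closed.
  exact: (@filterT _ (nbhs (b : weak_star X))).
by exists t => // p [_ [/= np _]] _.
Qed.

End perturbation.
End ball_derivation_theory.

(** * Uniform boundedness and weak* compactness *)

Section scalars.
Variables (R : realType) (s : scalar_kind).

Lemma scalars_archi (x : scalars R s) : 0 <= x -> exists n : nat, x <= n%:R.
Proof.
case: s x => [x x0|x x0] /=; first by exists (Num.truncn x).+1; exact/ltW/truncnS_gt.
exists (Num.truncn (complex.Re x)).+1.
have xr : (complex.Re x)%:C%C = x by rewrite RRe_real// ger0_real.
rewrite -xr -(rmorph_nat (real_complex R)) lecR; exact/ltW/truncnS_gt.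
Qed.

(** A compact set containing the ball suffices for weak* compactness. In the complex case it is a
    square, the continuous image of a product of two segments. *)
Lemma scalars_ball_compact (M : scalars R s) :
  exists2 C : set (scalars R s)^o, compact C & forall z, `|z| <= M -> C z.
Proof.
case: s M => /= M.
  exists [set` `[- M, M]] => [|z]; first exact: segment_compact.
  by rewrite ler_norml /= in_itv.
pose m := complex.Re M.
pose h (p : R * R) : R[i]^o := (p.1 +i* p.2)%C.
exists (h @` ([set` `[- m, m]] `*` [set` `[- m, m]])).
  apply: continuous_compact; last by apply: compact_setX; exact: segment_compact.
  apply: continuous_subspaceT => p; apply/(@cvgrPdist_lt _ R[i]^o) => e e0.
  have er : (complex.Re e)%:C%C = e by rewrite RRe_real// gtr0_real.
  have e0' : 0 < complex.Re e / 2 by rewrite divr_gt0// -ltcR er.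
  exists (ball p.1 (complex.Re e / 2), ball p.2 (complex.Re e / 2)).
    by split; apply: nbhsx_ballx.
  move=> [a b] /= [pa pb]; rewrite -er /h/=.
  rewrite (_ : _ - _ = (p.1 - a)%:C + 'i * (p.2 - b)%:C)%C; last first.
    by rewrite [LHS]complexE.
  apply: le_lt_trans (ler_normD _ _) _.
  rewrite normrM !normc_def /= !expr0n /= expr1n add0r !addr0 !sqrtr_sqr sqrtr1 mul1r.
  by rewrite -rmorphD ltcR [ltRHS]splitr ltrD.
move=> z zM; exists (complex.Re z, complex.Im z); last by case: z zM.
have MR : M = m%:C%C by rewrite RRe_real// ger0_real// (le_trans _ zM).
have mz : Num.sqrt (complex.Re z ^+ 2 + complex.Im z ^+ 2) <= m.
  by rewrite -lecR -MR -normc_def.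
have m0 : 0 <= m by apply: le_trans mz; exact: sqrtr_ge0.
case: z {zM} mz => a b /= ab.
have ab2 : a ^+ 2 + b ^+ 2 <= m ^+ 2.
  by rewrite -(sqr_sqrtr (addr_ge0 (sqr_ge0 a) (sqr_ge0 b))) ler_sqr// nnegrE.
split=> /=; rewrite in_itv /= -ler_norml -ler_sqr ?nnegrE// real_normK ?num_real//.
  by apply: le_trans ab2; rewrite lerDl sqr_ge0.
by apply: le_trans ab2; rewrite lerDr sqr_ge0.
Qed.

End scalars.

Section uniform_boundedness.
Variables (k : numFieldType) (X : completeNormedModType k).
Hypothesis archi : forall x : k, 0 <= x -> exists n : nat, x <= n%:R.

(** Without a uniform bound there are nested balls with radii tending to 0 such that some member of
    [K] exceeds [n] throughout the ball of index [n + 1]. Completeness gives a common point, at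
    which [K] is unbounded. *)
Lemma uniform_boundedness (K : set (dual X)) :
  (forall x, exists M : k, forall f, K f -> `|f x| <= M) ->
  exists2 D : k, 0 <= D & forall f, K f -> dnorm_le f D.
Proof.
move=> pb; apply: contrapT => nD.
have large n (x0 : X) (r : k) : 0 < r -> exists (f : dual X) y,
    [/\ K f, `|y - x0| < r & n%:R < `|f y|].
  (* This constant gives [2n < |f v|] for some [v] of norm [r / 2]; then [f] exceeds [n] in modulus
     at [x0] or at [x0 + v]. *)
  move=> r0; pose D := 4 * n%:R / r.
  have D0 : 0 <= D by rewrite divr_ge0 ?mulr_ge0 ?ler0n ?ltW.
  have [f [x [Kf fx]]] : exists (f : dual X) x, K f /\ D * `|x| < `|f x|.
    apply: contrapT => H; apply: nD; exists D => // f Kf x.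
    rewrite real_leNgt ?normr_real ?(ger0_real (mulr_ge0 D0 (normr_ge0 x)))//.
    by apply/negP => lt; apply: H; exists f, x.
  have x_gt0 : 0 < `|x|.
    rewrite normr_gt0; apply: contraPN fx => /eqP ->.
    by rewrite -(scale0r x0) dual_appZ mul0r scale0r !normr0 mulr0 ltxx.
  pose v := (r / 2 / `|x|) *: x.
  have rx : 0 < r / 2 / `|x| by rewrite !divr_gt0.
  have fv : 2 * n%:R < `|f v|.
    rewrite dual_appZ normrM (gtr0_norm rx).
    rewrite (_ : 2 * n%:R = r / 2 / `|x| * (D * `|x|)) ?ltr_pM2l//.
    by rewrite /D; field; rewrite !gt_eqF.
  have nfv : `|v| = r / 2 by rewrite normrZ gtr0_norm// divfK// gt_eqF.
  have [lt|ge] := real_ltP (realn k n) (normr_real (f x0)).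
    by exists f, x0; rewrite subrr normr0.
  exists f, (x0 + v); split=> //.
    by rewrite addrAC subrr add0r nfv ltr_pdivrMr// ltr_pMr// ltr1n.
  rewrite dual_appD addrC; apply: lt_le_trans (lerB_normD _ _).
  by rewrite ltrBrDr (le_lt_trans _ fv)// mulr_natl mulr2n lerD2l.
have step (n : nat) (x0 : X) (r : k) : 0 < r -> exists y q,
    [/\ 0 < q, q <= r / 2, `|y - x0| + q <= r &
        exists2 f : dual X, K f & forall z, `|z - y| <= q -> n%:R < `|f z|].
  move=> r0; have r2 : 0 < r / 2 by rewrite divr_gt0.
  have [f [y [Kf yx0 nfy]]] := large n x0 _ r2.
  have e0 : 0 < `|f y| - n%:R by rewrite subr_gt0.
  have /(@cvgrPdist_lt _ k^o)/(_ _ e0)/nbhs_ballP[d /= d0 Hd] := @dual_continuous _ _ f y.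
  have d2 : 0 < d / 2 by rewrite divr_gt0.
  have [q [q0 qd qr]] : exists q, [/\ 0 < q, q <= d / 2 & q <= r / 2].
    have [le|lt] := real_leP (gtr0_real d2) (gtr0_real r2).
      by exists (d / 2).
    by exists (r / 2); split=> //; exact: ltW.
  exists y, q; split=> //; first by rewrite [leRHS]splitr lerD// ltW.
  exists f => // z zy; have : ball y d z.
    rewrite -ball_normE /= distrC; apply: le_lt_trans zy _.
    by apply: le_lt_trans qd _; rewrite ltr_pdivrMr// ltr_pMr// ltr1n.
  move=> /Hd /=; rewrite ltrBrDl addrC => lt.
  rewrite -(ltrD2l `|f y - f z|) (lt_le_trans lt)//.
  by rewrite -{1}(subrK (f z) (f y)) ler_normD.
(* The step is made a total function; at a radius that is not positive its value is arbitrary. *)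
have /choice[nx nxP] : forall p : nat * (X * k), exists p' : X * k, 0 < p.2.2 ->
    [/\ 0 < p'.2, p'.2 <= p.2.2 / 2, `|p'.1 - p.2.1| + p'.2 <= p.2.2 &
        exists2 f : dual X, K f & forall z, `|z - p'.1| <= p'.2 -> p.1%:R < `|f z|].
  move=> [n [x0 r]] /=; have [r0|r0] := pselect (0 < r).
    by have [y [q H]] := step n x0 _ r0; exists (y, q).
  by exists (x0, r).
pose u := fix u n := if n is m.+1 then nx (m, u m) else (0 : X, 1 : k).
have u0 n : 0 < (u n).2.
  elim: n => [|n IH] /=; first exact: ltr01.
  by have [] := nxP (n, u n) IH.
have uP n := nxP (n, u n) (u0 n).
have usub n m z : `|z - (u (n + m)%N).1| <= (u (n + m)%N).2 -> `|z - (u n).1| <= (u n).2.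
  elim: m z => [|m IH] z; first by rewrite addn0.
  rewrite addnS => zu; apply: IH; have [_ _ + _] := uP (n + m)%N; apply: le_trans.
  by rewrite -[z - _](subrKA (u (n + m).+1).1) (le_trans (ler_normD _ _))// addrC lerD2l.
(* Radii are at least halved each time, so this weak bound follows from [n + 2 <= 2 * (n + 1)]. With
   [archi] it makes the centers a Cauchy sequence. *)
have usmall n : (u n).2 * n.+1%:R <= 1.
  elim: n => [|n IH]; first by rewrite mulr1.
  have [_ un _ _] := uP n; apply: le_trans IH.
  apply: le_trans (ler_wpM2r _ un) _; rewrite ?ler0n//= -mulrA ler_pM2l//.
  by rewrite mulrC ler_pdivrMr// -natrM ler_nat muln2 -addnn !addSn addnS ltnS ltnS leq_addr.
have uc : cauchy ((fun n => (u n).1) @ \oo).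
  apply: cauchy_exP => e e0.
  have ei : 0 <= e^-1 by rewrite invr_ge0 ltW.
  have [n ne] := archi ei.
  exists (u n).1, n => // m /= nm; rewrite -ball_normE /= distrC.
  have : `|(u m).1 - (u n).1| <= (u n).2.
    by apply: (usub n (m - n)%N); rewrite subnKC// subrr normr0 ltW.
  move=> /le_lt_trans; apply.
  rewrite -(ltr_pM2r (ltr0Sn k n)); apply: le_lt_trans (usmall n) _.
  by rewrite -ltr_pdivrMl// mulr1 (le_lt_trans ne)// ltr_nat.
have [x xP] : exists x : X, (fun n => (u n).1) @ \oo --> x.
  by apply/cvg_ex; exact: cauchy_cvg.
have xu n : `|x - (u n).1| <= (u n).2.
  have ur : (u n).2 \is Num.real by exact: gtr0_real.
  rewrite real_leNgt ?normr_real//; apply/negP => lt.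
  have d0 : 0 < `|x - (u n).1| - (u n).2 by rewrite subr_gt0.
  have /cvgrPdist_lt/(_ _ d0)[N _ /(_ (n + N)%N)] := xP.
  rewrite /= leq_addl => /(_ isT); rewrite ltrBrDr.
  apply/negP; rewrite -real_leNgt ?normr_real ?realD ?normr_real//.
  rewrite -[x - (u n).1](subrKA (u (n + N)%N).1).
  apply: le_trans (ler_normD _ _) _; rewrite lerD2l.
  by apply: (usub n N); rewrite subrr normr0 ltW.
have [M HM] := pb x.
have [_ _ _ [f0 Kf0 _]] := uP 0%N.
have M0 : 0 <= M by apply: le_trans (HM _ Kf0).
have [n Mn] := archi M0.
have [_ _ _ [f Kf fx]] := uP n; have := fx x (xu n.+1).
move=> /lt_le_trans/(_ (HM _ Kf)) /lt_le_trans/(_ Mn).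
by rewrite ltxx.
Qed.

End uniform_boundedness.

Section alaoglu.
Variables (k : numFieldType) (X : normedModType k).
Hypothesis ballC : forall M : k,
  exists2 C : set k^o, compact C & forall z, `|z| <= M -> C z.

(** At each [x] the ultrafilter has its values in a compact set of scalars, so they converge. The
    pointwise limit inherits linearity and the bound [D], hence is continuous. *)
Lemma alaoglu (A : set (dual X)) (D : k) : 0 <= D ->
  closed (A : set (weak_star X)) -> (forall f, A f -> dnorm_le f D) ->
  compact (A : set (weak_star X)).
Proof.
move=> D0 cA AD; rewrite compact_ultra => F FU FA.
have FF : ProperFilter F by exact: ultra_proper.
have lim_ex x : exists z : k^o,
    (fun g : weak_star X => (g : dual X) x : k^o) @ F --> z.
  have [C cC HC] := ballC (D * `|x|).
  have GC : ((fun g : weak_star X => (g : dual X) x : k^o) @ F) C.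
    by apply: (@filterS _ F _ _ _ _ FA) => g /AD/(_ x)/HC.
  have [z [_ clz]] := cC _ (fmap_proper_filter _ _) GC.
  exists z => V zV.
  have [//|FnV] := in_ultra_setVsetC ((fun g : weak_star X => (g : dual X) x : k^o) @^-1` V) FU.
  by have [w [nVw Vw]] := clz (~` V) V FnV zV.
pose g x := projT1 (cid (lim_ex x)).
have gP x : (fun g : weak_star X => (g : dual X) x : k^o) @ F --> (g x : k^o).
  exact: projT2 (cid (lim_ex x)).
have glin : linear (g : X -> k^o).
  move=> a x y.
  have H : (fun g : weak_star X => (g : dual X) (a *: x + y) : k^o) @ F -->
     (a *: (g x : k^o) + (g y : k^o)).
    rewrite (_ : (fun g : weak_star X => _) =
      (fun g : weak_star X => a *: ((g : dual X) x : k^o) + ((g : dual X) y : k^o))).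
      by apply: cvgD (gP y); apply: cvgZr; exact: gP.
    by apply/funext => h; rewrite dual_appD dual_appZ.
  exact: (cvg_unique (@norm_hausdorff _ k^o) (gP (a *: x + y)) H).
have gle x : `|g x| <= D * `|x|.
  rewrite real_leNgt ?normr_real ?ger0_real ?mulr_ge0//; apply/negP => lt.
  have e0 : 0 < `|g x| - D * `|x| by rewrite subr_gt0.
  have /cvgrPdist_lt/(_ _ e0) Fx := gP x.
  have [h [/= hx Ah]] := filter_ex (filterI Fx FA).
  move: hx; rewrite ltrBrDr; apply/negP.
  rewrite -real_leNgt ?normr_real ?realD ?normr_real ?ger0_real ?mulr_ge0//.
  rewrite -{1}(subrK (h x) (g x)); apply: le_trans (ler_normD _ _) _.
  by rewrite lerD2l; exact: AD.
have gcont : continuous (g : X -> k^o).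
  move=> x; apply/cvgrPdist_lt => e e0.
  have D1 : 0 < D + 1 by rewrite ltr_wpDl.
  apply/nbhs_ballP; exists (e / (D + 1)); first exact: divr_gt0.
  move=> y; rewrite -ball_normE /= ltr_pdivlMr// => xy.
  have -> : g x - g y = g (x - y).
    by have := glin (-1) y x; rewrite !scaleN1r ![- _ + _]addrC.
  apply: le_lt_trans (gle _) _; apply: le_lt_trans xy.
  by rewrite mulrC ler_wpM2l// lerDl.
have gd : (g : X -> k^o) \in @dual_pred k X by apply/asboolP.
have Fg : F --> (Dual gd : weak_star X) by exact: (@weak_star_cvg k X F (Dual gd) _ gP).
exists (Dual gd); split=> //.
by apply: cA => V /Fg FV; apply: (@filter_ex _ F); exact: filterI.
Qed.

End alaoglu.

(** * Closed convex hulls *)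

Section convexity.
Variables (k : numFieldType) (X : normedModType k).
Implicit Types (f g : dual X) (A B C : set (dual X)) (t : k).

Definition cvx A := forall t f g, 0 <= t -> t <= 1 -> A f -> A g ->
  A (t *: f + (1 - t) *: g).

Lemma cvx_convex_set A : cvx A <-> @convex_set k (dual X) A.
Proof.
split=> [cA f g l /set_mem Af /set_mem Ag|cA t f g t0 t1 Af Ag].
  by apply/mem_set/cA.
exact: set_mem (cA f g (Itv01 t0 t1) (mem_set Af) (mem_set Ag)).
Qed.

Lemma sub_convex_hull A : A `<=` convex_hull A.
Proof. exact: sub_gen_smallest. Qed.

Lemma convex_hull_cvx A : cvx (convex_hull A).
Proof.
move=> t f g t0 t1 Af Ag B BA; have /cvx_convex_set cB := BA.1.
exact: cB t0 t1 (Af B BA) (Ag B BA).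
Qed.

Lemma convex_hull_min A B : cvx B -> A `<=` B -> convex_hull A `<=` B.
Proof. by move=> /cvx_convex_set cB AB; exact: smallest_sub. Qed.

Lemma wclose_comb xs (r t : k) f f' g g' : 0 <= t -> t <= 1 ->
  wclose xs r f f' -> wclose xs r g g' ->
  wclose xs r (t *: f + (1 - t) *: g) (t *: f' + (1 - t) *: g').
Proof.
move=> t0 t1 ff gg x xxs; rewrite !dualDE !dualZE.
have -> : t * f' x + (1 - t) * g' x - (t * f x + (1 - t) * g x) =
  t * (f' x - f x) + (1 - t) * (g' x - g x) by ring.
have t1' : 0 <= 1 - t by rewrite subr_ge0.
apply: le_lt_trans (ler_normD _ _) _; rewrite !normrM (ger0_norm t0) (ger0_norm t1').
(* Strictness comes from the first term, which requires [t > 0]; for [t = 0] only the second term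
   remains. *)
have [->|tn0] := eqVneq t 0; first by rewrite mul0r add0r subr0 mul1r; exact: gg.
have -> : r = t * r + (1 - t) * r by ring.
apply: ltr_leD; first by rewrite ltr_pM2l ?ff// lt_def tn0.
by rewrite ler_wpM2l// ltW// gg.
Qed.

Lemma wclose_sym xs (r : k) f g : wclose xs r f g -> wclose xs r g f.
Proof. by move=> H x /H; rewrite distrC. Qed.

Lemma wclose_refl xs (r : k) f : 0 < r -> wclose xs r f f.
Proof. by move=> r0 x _; rewrite subrr normr0. Qed.

Lemma wclose_trans xs (r r' : k) f g h :
  wclose xs r f g -> wclose xs r' g h -> wclose xs (r + r') f h.
Proof.
move=> H H' x xxs; rewrite -(subrKA (g x)) addrC.
by apply: le_lt_trans (ler_normD _ _) (ltrD (H x xxs) (H' x xxs)).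
Qed.

Lemma closure_cvx A : cvx A -> cvx (closure (A : set (weak_star X))).
Proof.
move=> cA t f g t0 t1 clf clg V /nbhs_wclose[xs [r [r0 HV]]].
have [f' Af' ff'] := closure_wclose clf xs r0.
have [g' Ag' gg'] := closure_wclose clg xs r0.
exists (t *: f' + (1 - t) *: g'); split; first exact: cA.
by apply: HV; exact: wclose_comb.
Qed.

Local Notation wscl := (@weak_star_closed_convex_hull k X).

Lemma wscl_closed A : closed (wscl A : set (weak_star X)).
Proof. exact: closed_closure. Qed.

Lemma convex_hull_sub_wscl A : convex_hull A `<=` wscl A.
Proof. exact: (@subset_closure (weak_star X)). Qed.

Lemma sub_wscl A : A `<=` wscl A.
Proof. by move=> f /sub_convex_hull/convex_hull_sub_wscl. Qed.

Lemma wscl_cvx A : cvx (wscl A).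
Proof. exact: (closure_cvx (@convex_hull_cvx A)). Qed.

Lemma wscl_min A B : closed (B : set (weak_star X)) -> cvx B -> A `<=` B -> wscl A `<=` B.
Proof.
move=> clB cB AB f clf; apply: clB; move: clf; apply: closureS.
exact: convex_hull_min.
Qed.

Lemma dnorm_le_cvx p (e : k) : cvx [set f | dnorm_le (f - p) e].
Proof.
move=> t f g t0 t1 /= fe ge.
have -> : t *: f + (1 - t) *: g - p = t *: (f - p) + (1 - t) *: (g - p).
  apply: dual_ext => x; rewrite !(dualDE, dualNE, dualZE); ring.
have -> : e = t * e + (1 - t) * e by ring.
by apply: dnorm_leD; apply: dnorm_leZ => //; rewrite subr_ge0.
Qed.

(* The guards [l = 0] allow for an empty [C]. *)
Lemma cvx_combine C (l1 l2 : k) f g : cvx C -> 0 <= l1 -> 0 <= l2 ->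
  l1 = 0 \/ C f -> l2 = 0 \/ C g ->
  exists2 h, l1 + l2 = 0 \/ C h & l1 *: f + l2 *: g = (l1 + l2) *: h.
Proof.
move=> cC l10 l20 [->|Cf]; first by exists g; rewrite add0r ?scale0r ?add0r.
move=> [->|Cg]; first by exists f; rewrite addr0 ?scale0r ?addr0; [right|].
have [E|ne] := eqVneq (l1 + l2) 0.
  have /eqP := E; rewrite paddr_eq0// => /andP[/eqP -> /eqP ->].
  by exists f; [right|rewrite addr0 !scale0r addr0].
have l_gt0 : 0 < l1 + l2 by rewrite lt_def ne addr_ge0.
exists ((l1 / (l1 + l2)) *: f + (1 - l1 / (l1 + l2)) *: g).
  right; apply: cC => //; first by rewrite divr_ge0// ltW.
  by rewrite ler_pdivrMr// mul1r lerDl.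
apply: dual_ext => x; rewrite !(dualDE, dualNE, dualZE).
by field.
Qed.

(** For nonempty convex sets this is the convex hull of the union. *)
Definition segments A B : set (dual X) :=
  [set h | exists t f g, [/\ 0 <= t, t <= 1, A f, B g & h = t *: f + (1 - t) *: g]].

Lemma segments_cvx A B : cvx A -> cvx B -> cvx (segments A B).
Proof.
move=> cA cB t _ _ t0 t1 [s1 [f1 [g1 [s10 s11 Af1 Bg1 ->]]]]
  [s2 [f2 [g2 [s20 s21 Af2 Bg2 ->]]]].
have t1' : 0 <= 1 - t by rewrite subr_ge0.
have s11' : 0 <= 1 - s1 by rewrite subr_ge0.
have s21' : 0 <= 1 - s2 by rewrite subr_ge0.
have [f Af Ef] := cvx_combine cA (mulr_ge0 t0 s10) (mulr_ge0 t1' s20)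
  (or_intror Af1) (or_intror Af2).
have [g Bg Eg] := cvx_combine cB (mulr_ge0 t0 s11') (mulr_ge0 t1' s21')
  (or_intror Bg1) (or_intror Bg2).
pose l := t * s1 + (1 - t) * s2.
have El : t * (1 - s1) + (1 - t) * (1 - s2) = 1 - l by rewrite /l; ring.
have l0 : 0 <= l by rewrite addr_ge0// mulr_ge0.
have l1 : 0 <= 1 - l by rewrite -El addr_ge0// mulr_ge0.
(* A component of weight zero need not lie in its set; it is then replaced by a known member. *)
exists l, (if l == 0 then f1 else f), (if 1 - l == 0 then g1 else g); split=> //.
- by rewrite -subr_ge0.
- by case: eqP => // nl; case: Af => // /nl.
- by case: eqP => // nl; case: Bg => //; rewrite El.
- have -> : t *: (s1 *: f1 + (1 - s1) *: g1) + (1 - t) *: (s2 *: f2 + (1 - s2) *: g2) =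
     ((t * s1) *: f1 + ((1 - t) * s2) *: f2) +
     ((t * (1 - s1)) *: g1 + ((1 - t) * (1 - s2)) *: g2).
    by apply: dual_ext => x; rewrite !(dualDE, dualNE, dualZE); ring.
  rewrite Ef Eg El -/l; congr (_ + _).
    by case: eqP => // ->; rewrite !scale0r.
  by case: eqP => // ->; rewrite !scale0r.
Qed.

(** Norm balls are weak* closed, so finitely many balls that miss [f] also miss a neighborhood of
    it. This carries coverings over to weak* closures, and later bounds diameters near [f]. *)
Lemma nbhs_not_close (P : seq (dual X)) f (e : k) : 0 <= e -> nbhs (f : weak_star X)
  [set h | forall p, p \in P -> dnorm_le (h - p) e -> dnorm_le (f - p) e].
Proof.
move=> e0; elim: P => [|p P IH].
  rewrite (_ : [set h | _] = setT); first exact: (@filterT _ (nbhs (f : weak_star X))).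
  by apply/seteqP; split=> // h _ p; rewrite in_nil.
have [fp|fp] := pselect (dnorm_le (f - p) e).
  apply: (@filterS _ (nbhs (f : weak_star X)) _ _ _ _ IH) => h hP q.
  by rewrite in_cons => /predU1P[->|/hP].
have : nbhs (f : weak_star X) (~` [set h | dnorm_le (h - p) e]).
  by apply: open_nbhs_nbhs; split=> //; exact/closed_openC/dnorm_le_closed.
move=> /(@filterI _ (nbhs (f : weak_star X)) _ _ _ IH).
apply: (@filterS _ (nbhs (f : weak_star X))) => h [hP hp] q.
by rewrite in_cons => /predU1P[->|/hP].
Qed.

End convexity.

(** * Hulls of sets covered by finitely many balls *)

Section total_boundedness.
Variables (k : numFieldType) (X : normedModType k).
Hypothesis archi : forall x : k, 0 <= x -> exists n : nat, x <= n%:R.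
Hypothesis dual_bounded : forall f : dual X, exists2 D : k, 0 <= D & dnorm_le f D.

Lemma unit_interval_net (e : k) : 0 < e -> exists ts : seq k,
  forall t, 0 <= t -> t <= 1 -> exists2 t', t' \in ts & `|t - t'| <= e.
Proof.
move=> e0; have ei : 0 <= e^-1 by rewrite invr_ge0 ltW.
have [n ne] := archi ei; pose N : k := n.+1%:R.
have N0 : 0 < N by rewrite ltr0Sn.
have Ne : N^-1 <= e.
  by rewrite -[e]invrK lef_pV2 ?posrE ?invr_gt0// (le_trans ne)// ler_nat.
exists [seq i%:R / N | i <- iota 0 n.+2] => t t0 t1.
have exi : exists i, i%:R / N <= t by exists 0%N; rewrite mul0r.
have bi i : i%:R / N <= t -> (i <= n.+1)%N.
  by move=> /le_trans/(_ t1); rewrite ler_pdivrMr// mul1r ler_nat.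
case: (ex_maxnP exi bi) => i it imax.
exists (i%:R / N); first by apply/mapP; exists i => //; rewrite mem_iota add0n /= ltnS bi.
rewrite ger0_norm ?subr_ge0//; apply: le_trans Ne.
have tr : t \is Num.real by exact: ger0_real.
have ir : i.+1%:R / N \is Num.real by rewrite ger0_real// divr_ge0 ?ler0n ?ltW.
have [/imax|lt] := real_leP ir tr; first by rewrite ltnn.
have Ei : N^-1 + i%:R / N = i.+1%:R / N by rewrite -natr1 mulrDl mul1r addrC.
by rewrite lerBlDr Ei ltW.
Qed.

(** [T] is covered at a radius [d'] between [e] and [d]. Moving [t] to a finite net of mesh
    [(d - d') / (C + 1)], where [C] bounds the distances from [p] to the centers, costs at most
    [d - d']. *)
Lemma ball_cover_segments (e d : k) (p : dual X) (T : set (dual X)) : 0 <= e -> e < d ->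
  (forall d', e < d' -> ball_cover d' T) ->
  ball_cover d (segments [set f | dnorm_le (f - p) e] T).
Proof.
move=> e0 ed HT; pose d' := (e + d) / 2.
have ed' : e < d' by rewrite ltr_pdivlMr// mulr_natr mulr2n ltrD2l.
have d'd : d' < d by rewrite ltr_pdivrMr// mulr_natr mulr2n ltrD2r.
have [Q HQ] := HT d' ed'.
have [C C0 HC] : exists2 C : k, 0 <= C & forall q, q \in Q -> dnorm_le (p - q) C.
  elim: (Q) => [|q Q' [C C0 HC]]; first by exists 0.
  have [D D0 HD] := dual_bounded (p - q).
  exists (D + C); first exact: addr_ge0.
  move=> q'; rewrite in_cons => /predU1P[->|/HC HCq].
    by apply: dnorm_le_le HD; rewrite lerDl.
  by apply: dnorm_le_le HCq; rewrite lerDr.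
have eta0 : 0 < (d - d') / (C + 1) by rewrite divr_gt0 ?subr_gt0// ltr_wpDl.
have [ts Hts] := unit_interval_net eta0.
exists [seq t *: p + (1 - t) *: q | t <- ts, q <- Q].
move=> _ [t [f [g [t0 t1 /= fp /HQ[q qQ gq] ->]]]].
have [t' t'ts tt'] := Hts t t0 t1.
exists (t' *: p + (1 - t') *: q); first exact: allpairs_f.
have -> : t *: f + (1 - t) *: g - (t' *: p + (1 - t') *: q) =
  (t *: (f - p) + (1 - t) *: (g - q)) + (t - t') *: (p - q).
  by apply: dual_ext => x; rewrite !(dualDE, dualNE, dualZE); ring.
have t1' : 0 <= 1 - t by rewrite subr_ge0.
have -> : d = (t * d' + (1 - t) * d') + (d - d') by ring.
apply: dnorm_leD; first apply: dnorm_leD; first apply: dnorm_leZ => //.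
- exact: dnorm_le_le (ltW ed') fp.
- exact: dnorm_leZ.
move=> x; rewrite dualZE normrM.
apply: le_trans (ler_pM (normr_ge0 _) (normr_ge0 _) tt' (HC q qQ x)) _.
rewrite mulrA ler_wpM2r// mulrAC ler_pdivrMr ?ltr_wpDl// ler_wpM2l ?lerDl//.
by rewrite subr_ge0 ltW.
Qed.

(** The balls are joined one after another to a convex set [T]. Each joining enlarges the radius
    slightly, hence the invariant over all radii above [e]; a point of [T] is needed to place the
    new ball inside the join. *)
Lemma ball_cover_wscl (e d : k) A : 0 <= e -> e < d -> ball_cover e A ->
  ball_cover d (@weak_star_closed_convex_hull k X A).
Proof.
move=> e0 ed [P HP].
suff [T [cT HT PT]] : exists T : set (dual X), [/\ cvx T,
   (forall d', e < d' -> ball_cover d' T) &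
   (T !=set0 /\ forall f p, p \in P -> dnorm_le (f - p) e -> T f)].
  have [Q HQ] := HT d ed.
  exists Q => f clf; apply: contrapT => nQ.
  have dd : 0 <= d by rewrite ltW// (le_lt_trans e0).
  have clT : closure (T : set (weak_star X)) f.
    move: clf; apply: closureS; apply: convex_hull_min => // h /HP[p pP hp].
    exact: PT.2 pP hp.
  have [h [Th hQ]] := clT _ (nbhs_not_close Q f dd).
  by have [q qQ hq] := HQ h Th; apply: nQ; exists q => //; exact: hQ.
elim: P {HP} => [|p P [T [cT HT [[g Tg] PT]]]].
  exists [set 0]; split.
  - by move=> t f g _ _ /= -> ->; rewrite !scaler0 addr0.
  - move=> d' ed'; exists [:: 0] => f /= ->; exists 0; first exact: mem_head.
    by rewrite subrr; apply: dnorm_le0; rewrite ltW// (le_lt_trans e0).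
  - by split; first by exists 0.
exists (segments [set f | dnorm_le (f - p) e] T); split.
- by apply: segments_cvx cT; exact: dnorm_le_cvx.
- by move=> d' ed'; exact: ball_cover_segments.
- have pp : dnorm_le (p - p) e by rewrite subrr; exact: dnorm_le0.
  split; first by exists p; exists 1, p, g; split=> //; rewrite subrr scale0r scale1r addr0.
  move=> f q; rewrite in_cons => /predU1P[->|/PT Tf] fq.
    by exists 1, f, g; split=> //; rewrite subrr scale0r scale1r addr0.
  by exists 0, p, f; split=> //; [exact: Tf|rewrite scale0r add0r subr0 scale1r].
Qed.

End total_boundedness.

Section hull_bounds.
Variables (R : realType) (s : scalar_kind) (X : completeNormedModType (scalars R s)).
Local Notation k := (scalars R s).

Lemma weak_star_compact_bounded (K : set (dual X)) : compact (K : set (weak_star X)) ->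
  exists2 D : k, 0 <= D & forall f, K f -> dnorm_le f D.
Proof.
move=> cK; apply: uniform_boundedness; first exact: scalars_archi.
move=> x.
(* Bounds are kept nonnegative so that [M + M'] dominates both [M] and [M']. *)
suff [M _ HM] : exists2 M : k, 0 <= M & forall f, K f -> `|f x| <= M by exists M.
apply: (compact_local (P := fun S : set (weak_star X) =>
  exists2 M : k, 0 <= M & forall f : dual X, S f -> `|f x| <= M) cK).
- by move=> S S' SS [M M0 HM]; exists M => // f /SS/HM.
- by exists 0.
- move=> S S' [M M0 HM] [M' M'0 HM']; exists (M + M'); first exact: addr_ge0.
  by move=> f [/HM|/HM'] /le_trans; apply; rewrite ?lerDl ?lerDr.
move=> f Kf; exists (wclose [:: x] 1 f); first exact: wclose_nbhs.
exists (1 + `|(f : dual X) x|); first by rewrite addr_ge0.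
move=> g [_ /(_ x)]; rewrite mem_head => /(_ isT) /ltW gf.
rewrite -[g x](subrK ((f : dual X) x)); apply: le_trans (ler_normD _ _) _.
by rewrite lerD2r.
Qed.

Lemma dual_bounded (f : dual X) : exists2 D : k, 0 <= D & dnorm_le f D.
Proof.
have [D D0 HD] := weak_star_compact_bounded (@compact_set1 (weak_star X) f).
by exists D => //; exact: HD.
Qed.

Lemma wscl_bounded (K : set (dual X)) : compact (K : set (weak_star X)) ->
  exists2 D : k, 0 <= D & forall f, weak_star_closed_convex_hull K f -> dnorm_le f D.
Proof.
move=> /weak_star_compact_bounded[D D0 HD]; exists D => // f Kf.
rewrite -(subr0 f); move: Kf; apply: (wscl_min (B := [set f | dnorm_le (f - 0) D])).
- exact: dnorm_le_closed.
- exact: dnorm_le_cvx.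
- by move=> g /HD /=; rewrite subr0.
Qed.

Lemma wscl_compact (K : set (dual X)) : compact (K : set (weak_star X)) ->
  compact (weak_star_closed_convex_hull K : set (weak_star X)).
Proof.
move=> /wscl_bounded[D D0 HD]; apply: (alaoglu _ D0) => //.
  exact: scalars_ball_compact.
exact: wscl_closed.
Qed.

End hull_bounds.

(** * Decay of the derived sets of a convex hull *)

Section levels.
Variables (k : numFieldType) (X : normedModType k).
Implicit Types (f g : dual X) (Kf : nat -> set (dual X)).

(* [level Kf y s] holds when [y] is the barycenter of a finitely supported
   probability measure on the disjoint union of the sets [Kf j] along which the
   index [j] has mean [s]. *)
Inductive level Kf : dual X -> k -> Prop :=
| level_gen j f : Kf j f -> level Kf f j%:R
| level_comb t f g a b : 0 <= t -> t <= 1 -> level Kf f a -> level Kf g b ->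
    level Kf (t *: f + (1 - t) *: g) (t * a + (1 - t) * b).

Lemma level_le Kf n y s : (forall j f, Kf j f -> (j <= n)%N) -> level Kf y s -> s <= n%:R.
Proof.
move=> Kn; elim=> [j f /Kn jn|t f g a b t0 t1 _ an _ bn]; first by rewrite ler_nat.
have -> : n%:R = t * n%:R + (1 - t) * n%:R by ring.
by apply: lerD; rewrite ler_wpM2l// subr_ge0.
Qed.

(** Turns a mixture with varying weight [m] into one with fixed weight [c]; for [0 <= m <= c] the
    new second component is a convex combination of [g] and [f]. *)
Lemma combination_split (c m : k) f g : 0 < c ->
  (1 - c) *: f + c *: ((m / c) *: g + (1 - m / c) *: f) = (1 - m) *: f + m *: g.
Proof.
move=> c0; apply: dual_ext => x; rewrite !(dualDE, dualNE, dualZE).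
by field; rewrite gt_eqF.
Qed.

Definition mean_ge Kf r : set (dual X) := [set y | exists2 s, r <= s & level Kf y s].

Lemma hull_mean_ge0 Kf : convex_hull (Kf 0%N) `<=` mean_ge Kf 0.
Proof.
apply: convex_hull_min => [t f g t0 t1 [a a0 fa] [b b0 gb]|f Kf0].
  exists (t * a + (1 - t) * b); last exact: level_comb.
  by rewrite addr_ge0// mulr_ge0// subr_ge0.
by exists 0%:R => //; exact: level_gen.
Qed.

(** The set [G] of the overview, with [wclose xs r] in the role of [W]. *)
Definition detached Kf xs (r : k) : set (dual X) :=
  [set f | exists2 j, Kf j f & ~ exists2 f', Kf j.+1 f' & wclose xs r f f'].

(* Moving the mass [m] carried by points close to the next level up by one level
   hardly changes the barycenter in the weak* sense, and adds [m] to the mean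
   level. *)
Lemma level_split Kf xs (r : k) y s : (forall j, Kf j `<=` Kf 0%N) -> 0 < r -> level Kf y s ->
  exists m g u y', [/\ 0 <= m <= 1, 1 - m = 0 \/ convex_hull (detached Kf xs r) g,
    convex_hull (Kf 0%N) u, y = (1 - m) *: g + m *: u &
    wclose xs r y y' /\ level Kf y' (s + m)].
Proof.
move=> K0 r0; elim=> [j f Kjf|t f1 f2 a b t0 t1 _ H1 _ H2].
  have uf : convex_hull (Kf 0%N) f by apply: sub_convex_hull; exact: K0 Kjf.
  (* Either the whole mass moves, [m = 1], and the dummy [g = 0] is allowed by the guard; or none
     moves, [m = 0], and [u] has no weight. *)
  have [[f' Kf' ff']|nf] := pselect (exists2 f', Kf j.+1 f' & wclose xs r f f').
    exists 1, 0, f, f'; rewrite ler01 lexx subrr scale0r scale1r add0r; split=> //.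
      by left.
    by split=> //; rewrite natr1; exact: level_gen.
  exists 0, f, f, f; rewrite ler01 lexx subr0 scale0r scale1r !addr0; split=> //.
    by right; apply: sub_convex_hull; exists j.
  by split; [exact: wclose_refl|exact: level_gen].
have [m1 [g1 [u1 [y1 [/andP[m10 m11] Hg1 Hu1 -> [w1 l1]]]]]] := H1.
have [m2 [g2 [u2 [y2 [/andP[m20 m21] Hg2 Hu2 -> [w2 l2]]]]]] := H2.
have t1' : 0 <= 1 - t by rewrite subr_ge0.
have m11' : 0 <= 1 - m1 by rewrite subr_ge0.
have m21' : 0 <= 1 - m2 by rewrite subr_ge0.
have scaled (C : set (dual X)) (l l' : k) g : l = 0 \/ C g -> l' * l = 0 \/ C g.
  by move=> [->|]; [rewrite mulr0; left|right].
have [g Hg Eg] := cvx_combine (@convex_hull_cvx _ _ _) (mulr_ge0 t0 m11')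
  (mulr_ge0 t1' m21') (scaled _ _ t _ Hg1) (scaled _ _ (1 - t) _ Hg2).
have [u0 Hu Eu] := cvx_combine (@convex_hull_cvx _ _ _) (mulr_ge0 t0 m10)
  (mulr_ge0 t1' m20) (or_intror Hu1) (or_intror Hu2).
pose m := t * m1 + (1 - t) * m2.
have Em : t * (1 - m1) + (1 - t) * (1 - m2) = 1 - m by rewrite /m; ring.
have m0 : 0 <= m by rewrite addr_ge0// mulr_ge0.
have m1' : 0 <= 1 - m by rewrite -Em addr_ge0// mulr_ge0.
rewrite Em in Hg Eg.
exists m, g, (if m == 0 then u1 else u0), (t *: y1 + (1 - t) *: y2); split=> //.
- by rewrite m0 -subr_ge0.
- by case: eqP => // nm; case: Hu.
- have -> : t *: ((1 - m1) *: g1 + m1 *: u1) + (1 - t) *: ((1 - m2) *: g2 + m2 *: u2) =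
     ((t * (1 - m1)) *: g1 + ((1 - t) * (1 - m2)) *: g2) +
     ((t * m1) *: u1 + ((1 - t) * m2) *: u2).
    by apply: dual_ext => x; rewrite !(dualDE, dualNE, dualZE); ring.
  rewrite Eg Eu -/m; congr (_ + _).
  by case: eqP => // ->; rewrite !scale0r.
- split; first exact: wclose_comb.
  have -> : t * a + (1 - t) * b + m = t * (a + m1) + (1 - t) * (b + m2).
    by rewrite /m; ring.
  exact: level_comb.
Qed.

End levels.

Section szlenk_hull.
Variables (R : realType) (s : scalar_kind) (X : completeNormedModType (scalars R s)).
Local Notation k := (scalars R s).
Local Notation wscl := (@weak_star_closed_convex_hull k X).

(** The gap between [e] and [d] leaves room for the perturbation by [c L] and for the loss of radius
    in [ball_cover_wscl]. *)
Definition hull_decay th := forall (A : set (dual X)) (e d : k),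
  compact (A : set (weak_star X)) -> 0 <= e -> e < d ->
  ball_derived e A th = set0 -> ball_derived d (wscl A) th = set0.

Section one_step.
Variables (Kf : nat -> set (dual X)) (n : nat) (be : ord) (e d' d c D : k).
Hypotheses (KfS : forall j, ball_derived e (Kf j) be `<=` Kf j.+1)
  (Kf0 : forall j, Kf j `<=` Kf 0%N) (Kfn : forall j, (n <= j)%N -> Kf j = set0)
  (Kfc : forall j, closed (Kf j : set (weak_star X)))
  (cK : compact (Kf 0%N : set (weak_star X))).
Hypotheses (e0 : 0 <= e) (ed' : e < d') (c0 : 0 < c) (c1 : c <= 1) (dd' : d' + c * D <= d).
Hypothesis KD : forall f g, wscl (Kf 0%N) f -> wscl (Kf 0%N) g -> dnorm_le (f - g) D.
Hypothesis Hbe : hull_decay be.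

(** The derived set of order [be] of a piece [Gj j] lies both in this piece and in [Kf j.+1], which
    are disjoint. At most [n] pieces are nonempty, so the rule for unions applies. *)
Lemma detached_compact xs (r : k) : 0 < r ->
  compact (detached Kf xs r : set (weak_star X)) /\ ball_derived e (detached Kf xs r) be = set0.
Proof.
move=> r0.
pose Gj j : set (dual X) := Kf j `&` ~` [set f | exists2 f', Kf j.+1 f' & wclose xs r f f'].
have Gjc j : closed (Gj j : set (weak_star X)).
  apply: closedI; first exact: Kfc.
  apply: open_closedC; rewrite (_ : [set f | _] =
    \bigcup_(f' in Kf j.+1) (wclose xs r f' : set (weak_star X))).
    by apply: bigcup_open => f' _; exact: wclose_open.
  by apply/seteqP; split=> f [f' Kf' ff']; exists f' => //; exact: wclose_sym.
have Gj0 j : ball_derived e (Gj j) be = set0.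
  rewrite -subset0 => f Gf; have [_ nf] := ball_derived_sub Gf; apply: nf.
  exists f; last exact: wclose_refl.
  by apply: KfS; apply: ball_derived_mono Gf => //; exact: subIsetl.
pose G m : set (dual X) := [set f | exists2 j, (j < m)%N & Gj j f].
have GE : detached Kf xs r = G n.
  apply/seteqP; split=> f [j]; last by move=> _ [Kjf nf]; exists j.
  move=> Kjf nf; exists j => //; rewrite ltnNge; apply/negP => /Kfn E.
  by rewrite E in Kjf.
have GH m : closed (G m : set (weak_star X)) /\ ball_derived e (G m) be = set0.
  elim: m => [|m [IH1 IH2]].
    have -> : G 0%N = set0 by apply/seteqP; split=> // f [].
    by split; [exact: closed0|rewrite -subset0; exact: ball_derived_sub].
  have -> : G m.+1 = G m `|` Gj m.
    apply/seteqP; split=> f.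
      move=> [j]; rewrite ltnS leq_eqVlt => /predU1P[->|jm] Gjf; first by right.
      by left; exists j.
    by move=> [[j jm Gjf]|Gmf]; [exists j => //; exact: ltnW|exists m].
  split; first exact: closedU.
  rewrite -subset0; apply: subset_trans (ball_derivedU IH1 (Gjc m)) _.
  by rewrite IH2 Gj0 setU0.
rewrite GE; have [GH1 GH2] := GH n; split=> //.
by apply: (subclosed_compact GH1 cK) => f [j _ [/Kf0]].
Qed.

Lemma ball_derived_mean_ge r : ball_derived d (closure (mean_ge Kf r : set (weak_star X))) be `<=`
  closure (mean_ge Kf (r + c) : set (weak_star X)).
Proof.
move=> x xH; apply: contrapT => nx.
have [xs [rho [rho0 Hx]]] : exists xs rho, 0 < rho /\
    forall g, wclose xs rho x g -> ~ mean_ge Kf (r + c) g.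
  apply: nbhs_wclose.
  have := open_nbhs_nbhs (conj (closed_openC (@closed_closure (weak_star X) _)) nx).
  apply: (@filterS _ (nbhs (x : weak_star X))) => g ng gM.
  by apply: ng; exact: (@subset_closure (weak_star X)).
(* One half of [rho] is spent between [x] and [y], the other on moving mass from [y] to [y']. *)
have rho2 : 0 < rho / 2 by rewrite divr_gt0.
pose G := detached Kf xs (rho / 2).
have [cG G0] := detached_compact xs rho2.
have cwG : compact (wscl G : set (weak_star X)) by exact: wscl_compact.
have cwK : compact (wscl (Kf 0%N) : set (weak_star X)) by exact: wscl_compact.
pose F : set (dual X) := mix c @` (wscl G `*` wscl (Kf 0%N)).
have cF : closed (F : set (weak_star X)).
  apply: weak_star_compact_closed.
  apply: (@continuous_compact _ _ (mix c) _ _ (compact_setX cwG cwK)).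
  by apply: continuous_subspaceT; exact: mix_continuous.
pose V : set (weak_star X) := wclose xs (rho / 2) x.
have oV : open V by exact: wclose_open.
have VM : V `&` mean_ge Kf r `<=` F.
  move=> y [Vy [s' rs' ys']].
  have [m [g [u [y' [/andP[m0 m1] Hg Hu Ey [yy' ly']]]]]] := level_split xs Kf0 rho2 ys'.
  have mc : m < c.
    have [//|cm] := real_ltP (ger0_real m0) (gtr0_real c0).
    exfalso; apply: (Hx y'); first by rewrite [rho]splitr; exact: (wclose_trans Vy yy').
    by exists (s' + m) => //; exact: lerD.
  have Gg : convex_hull G g.
    case: Hg => // /eqP; rewrite subr_eq0 => /eqP m1'.
    by move: (lt_le_trans mc c1); rewrite -m1' ltxx.
  have GK : convex_hull G `<=` convex_hull (Kf 0%N).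
    apply: convex_hull_min; first exact: convex_hull_cvx.
    by move=> f [j /Kf0 Kf0f _]; exact: sub_convex_hull.
  exists (g, (m / c) *: u + (1 - m / c) *: g).
    split; first exact: convex_hull_sub_wscl.
    apply/convex_hull_sub_wscl; apply: convex_hull_cvx (Hu) (GK _ Gg).
      by rewrite divr_ge0// ltW.
    by rewrite ler_pdivrMr// mul1r ltW.
  by rewrite Ey; exact: combination_split.
(* As [F] is closed and [V] is open, the inclusion extends to the closure. *)
have VclM : V `&` closure (mean_ge Kf r : set (weak_star X)) `<=` F.
  move=> y [Vy clMy]; apply: cF => W Wy.
  have [z [Mz [Vz Wz]]] := clMy _ (filterI (open_nbhs_nbhs (conj oV Vy)) Wy).
  by exists z; split=> //; exact: VM.
have Fd : ball_derived d F be = set0.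
  rewrite -subset0; apply: subset_trans (ball_derived_mix cwG cwK _ _ _ dd' KD (th := be)) _.
  - exact: ltW.
  - by [].
  - exact: le_trans (ltW ed').
  - by rewrite (Hbe cG e0 ed' G0) => p [q [[]]].
have Vx : V x by exact: wclose_refl.
have := ball_derived_local oV (conj Vx xH).
by move=> /(ball_derived_mono (lexx d) VclM); rewrite Fd.
Qed.

End one_step.

Lemma ball_derived_hull_omuln (K : set (dual X)) (be : ord) (n : nat) (e d : k) :
  hull_decay be -> compact (K : set (weak_star X)) -> 0 <= e -> e < d ->
  ball_derived e K (omuln be n) = set0 -> exists N, ball_derived d (wscl K) (omuln be N) = set0.
Proof.
move=> Hbe cK e0 ed Kn0.
pose Kf j := ball_derived e K (omuln be j).
have KfE : Kf 0%N = K by rewrite /Kf /ball_derived derived0.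
have KfS j : ball_derived e (Kf j) be = Kf j.+1.
  by rewrite /Kf /ball_derived /= (derived_add (@ball_derivationK _ _ e)).
have [D D0 HD] := wscl_bounded cK.
pose d' := (e + d) / 2.
have ed' : e < d' by rewrite ltr_pdivlMr// mulr_natr mulr2n ltrD2l.
have d'd : d' < d by rewrite ltr_pdivrMr// mulr_natr mulr2n ltrD2r.
have dd0 : 0 < d - d' by rewrite subr_gt0.
(* [D + D] bounds the diameter of the hull; for [c = 1 / (q + 1)] the perturbation then has size at
   most [d - d']. *)
have [q Hq] : exists q : nat, (D + D) / (d - d') <= q%:R.
  by apply: scalars_archi; apply: divr_ge0; [exact: addr_ge0|exact: ltW].
pose c : k := q.+1%:R^-1.
have c0 : 0 < c by rewrite invr_gt0 ltr0Sn.
have c1 : c <= 1 by rewrite invf_le1 ?ltr0Sn// ler1n.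
have dd' : d' + c * (D + D) <= d.
  rewrite addrC -lerBrDr mulrC ler_pdivrMr ?ltr0Sn// mulrC -ler_pdivrMr//.
  by apply: le_trans Hq _; rewrite ler_nat.
have KD f g : wscl (Kf 0%N) f -> wscl (Kf 0%N) g -> dnorm_le (f - g) (D + D).
  rewrite KfE => /HD Hf /HD Hg; apply: dnorm_leD => // x.
  by rewrite dualNE normrN; exact: Hg.
have step i : ball_derived d (wscl K) (omuln be i) `<=`
    closure (mean_ge Kf (i%:R * c) : set (weak_star X)).
  elim: i => [|i IH].
    rewrite mul0r /ball_derived derived0 -KfE.
    exact: (@closureS (weak_star X) _ _ (@hull_mean_ge0 _ _ Kf)).
  rewrite /ball_derived /= (derived_add (@ball_derivationK _ _ d)).
  apply: (subset_trans (ball_derived_mono (lexx d) IH)).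
  have -> : i.+1%:R * c = i%:R * c + c by rewrite -natr1 mulrDl mul1r.
  apply: (@ball_derived_mean_ge Kf n be e d' d c (D + D)) => //.
  - by move=> j; rewrite KfS.
  - by move=> j; rewrite KfE; exact: ball_derived_sub.
  - move=> j nj; apply: (derived_empty (@ball_derivationK _ _ e) _ Kn0).
    rewrite -(subnK nj); elim: (j - n)%N => [|m IHm]; first exact: ole_refl.
    by rewrite addSn; apply: ole_trans IHm (oadd_lel _ _).
  - by move=> j; apply: ball_derived_closed; exact: weak_star_compact_closed.
  - by rewrite KfE.
(* This many steps of size [c] raise the mean to [n + 1], while no index above [n] has a nonempty
   set. *)
exists (n.+1 * q.+1)%N; rewrite -subset0 => f /step clf.
have [g [[t tge lt] _]] := clf setT (@filterT _ (nbhs (f : weak_star X)) _).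
have : t <= n%:R.
  apply: level_le lt => j h Kjh; rewrite leqNgt; apply/negP => nj.
  suff : Kf j = set0 by move=> E; rewrite E in Kjh.
  apply: (derived_empty (@ball_derivationK _ _ e) _ Kn0).
  rewrite -(subnK (ltnW nj)); elim: (j - n)%N => [|m IHm]; first exact: ole_refl.
  by rewrite addSn; apply: ole_trans IHm (oadd_lel _ _).
move=> /(le_trans tge); rewrite natrM mulfK ?pnatr_eq0// ler_nat.
by rewrite ltnn.
Qed.

Lemma hull_decay_gamma g : gamma_number g -> hull_decay g.
Proof.
elim: (olt_wf g) => {}g _ IH gg A e d cA e0 ed.
have [->|->|gl] := gamma_cases gg.
- rewrite /ball_derived !derived0 => ->; rewrite -subset0.
  by apply: wscl_min => //; exact: closed0.
(* By compactness, an empty first derived set means that [A] itself is covered by finitely many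
   balls. *)
- rewrite /ball_derived !derivedS !derived0 => A0.
  have bA : ball_cover e A.
    apply: (compact_local (P := ball_cover e : set (weak_star X) -> Prop) cA).
    + exact: ball_coverS.
    + exact: ball_cover0.
    + exact: ball_coverU.
    + move=> f Af; have [|V Vf bV] := @ball_derivationN _ _ e A f Af; first by rewrite A0.
      by exists V => //; rewrite setIC.
  have bL : ball_cover d (wscl A).
    apply: (ball_cover_wscl _ _ e0 ed bA); first exact: scalars_archi.
    exact: dual_bounded.
  rewrite -subset0 => f [_ /(_ setT)]; rewrite setTI; apply=> //.
  exact: (@filterT _ (nbhs (f : weak_star X)) _).
(* Some stage [eta < g] is already empty. The leading gamma number [b] of [eta] is below [g], so the
   induction hypothesis applies to it, and [b * N] stays below [g]. *)
- move=> /(ball_derived_lim_empty cA gl)[eta etag A0].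
  have g0 := olimit_gt0 gl.
  have [eta0|eta0] := pselect (olt ozero eta); last first.
    have E : eta = ozero by apply: contrapT => H; apply: eta0; split; [exact: ole0|exact/nesym].
    have AE : A = set0 by rewrite -A0 E /ball_derived derived0.
    rewrite -subset0 => f /ball_derived_sub; rewrite AE.
    by apply: wscl_min => //; exact: closed0.
  have [b [n [b0 bg beta etabn]]] := leading_gamma eta0.
  have btg : olt b g by exact: ole_lt_trans etag.
  have [N LN] := ball_derived_hull_omuln (IH _ btg bg) cA e0 ed
     (derived_empty (@ball_derivationK _ _ e) etabn A0).
  apply: (derived_empty (@ball_derivationK _ _ d) _ LN).
  exact/olt_ole/omuln_lt_gamma.
Qed.

End szlenk_hull.

(** * The Szlenk index *)

Section midpoint.
Variables (k : numFieldType) (X : normedModType k).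
Implicit Types (x y z : dual X) (L : set (dual X)).

Definition midpoint x z : dual X := 2^-1 *: z + (1 - 2^-1) *: x.

Lemma midpointC x z : midpoint x z = midpoint z x.
Proof. by apply: dual_ext => w; rewrite !(dualDE, dualNE, dualZE); field. Qed.

Lemma half01 : 0 <= 2^-1 :> k /\ 2^-1 <= 1 :> k.
Proof. by rewrite invr_ge0 ler0n invf_le1 ?ltr0n// ler1n. Qed.

(** Taking midpoints with [x] halves distances, so a cover of radius [e / 2] near the image pulls
    back to one of radius [e], with centers [2p - x]. *)
Lemma ball_derived_midpoint (e : k) A B th x z :
  (forall w, A w -> B (midpoint x w)) ->
  ball_derived e A th z -> ball_derived (e / 2) B th (midpoint x z).
Proof.
move=> AB Az.
apply: (derived_rel (rho := fun z w => w = midpoint x z) (d := ball_derivation e) (A := A)) Az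
  => //.
  move=> S S' SS {}z _ -> [Sz H]; split=> [|V /nbhs_wclose[xs [r [r0 HV]]] [P HP]].
    exact: (SS z).
  apply: (H _ (wclose_nbhs xs z r0)).
  exists [seq 2 *: p - x | p <- P] => w [zw Sw].
  have Vw : V (midpoint x w).
    by apply: HV; apply: wclose_comb zw _; rewrite ?half01.1 ?half01.2//; exact: wclose_refl.
  have [p pP wp] := HP _ (conj Vw (SS w _ erefl Sw)).
  exists (2 *: p - x); first exact: map_f.
  have -> : w - (2 *: p - x) = 2 *: (midpoint x w - p).
    by apply: dual_ext => v; rewrite !(dualDE, dualNE, dualZE); field.
  have -> : e = 2 * (e / 2) by field.
  by apply: dnorm_leZ; rewrite ?ler0n.
by move=> w _ -> /AB.
Qed.

Definition vanishes L th := forall e : k, 0 < e -> ball_derived e L th = set0.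

(** For [a, b < l], some [x] and [y] survive to the stages [a] and [b] at a common radius [d]; their
    midpoint survives to stage [a + b] at radius [d / 2]. *)
Lemma vanishes_least_gamma L l : cvx L -> vanishes L l ->
  (forall b, vanishes L b -> ole l b) -> gamma_number l.
Proof.
move=> cL Ll lmin a b.
have ex c : olt c l -> exists2 e : k, 0 < e & exists x, ball_derived e L c x.
  move=> /oltNge cl; apply: contrapT => H; apply/cl/lmin => e e0.
  by rewrite -subset0 => x Lx; apply: H; exists e => //; exists x.
move=> /ex[e e0 [x Lx]] /ex[e' e'0 [y Ly]].
have [d [d0 de de']] : exists d : k, [/\ 0 < d, d <= e & d <= e'].
  have [le|lt] := real_leP (gtr0_real e0) (gtr0_real e'0); first by exists e.
  by exists e'; split=> //; exact: ltW.
have {}Lx := ball_derived_mono de (@subset_refl _ L) Lx.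
have {}Ly := ball_derived_mono de' (@subset_refl _ L) Ly.
suff Lxy : ball_derived (d / 2) L (oadd a b) (midpoint x y).
  apply/oltNge => lab; have d2 : 0 < d / 2 by rewrite divr_gt0.
  have := derived_empty (@ball_derivationK _ _ (d / 2)) lab (Ll _ d2).
  by move: Lxy; rewrite /ball_derived => + E; rewrite E.
rewrite /ball_derived (derived_add (@ball_derivationK _ _ (d / 2))).
(* Every [z] in [L] has its midpoint with [x] in the derived set of order [a]. So taking midpoints
   with [x] maps [L] into that set, and [y] is followed through [b] further stages. *)
apply: (ball_derived_midpoint (A := L) (B := ball_derived (d / 2) L a)) Ly => z Lz.
rewrite midpointC; apply: ball_derived_midpoint Lx => w Lw.
by apply: cL => //; rewrite ?half01.1 ?half01.2.
Qed.

End midpoint.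

(** * Comparison of the Szlenk and ball derivations *)

Section norm_diameter.
Variables (R : realType) (s : scalar_kind).
Local Notation k := (scalars R s).

Definition scalar_of : R -> k :=
  match s return R -> scalars R s with
  | RealScalars => fun r => r
  | ComplexScalars => fun r => r%:C%C
  end.

Lemma scalar_le a b : (scalar_of a <= scalar_of b) = (a <= b).
Proof. by rewrite /scalar_of; case: s => //; rewrite lecR. Qed.

Lemma scalarD a b : scalar_of (a + b) = scalar_of a + scalar_of b.
Proof. by rewrite /scalar_of; case: s => //; rewrite rmorphD. Qed.

Lemma scalar0 : scalar_of 0 = 0.
Proof. by apply: (addrI (scalar_of 0)); rewrite -scalarD !addr0. Qed.

Lemma scalar_gt0 a : (0 < scalar_of a) = (0 < a).
Proof. by rewrite !lt_def -scalar0 scalar_le; congr (~~ _ && _); rewrite !eq_le !scalar_le. Qed.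

Lemma scalar_surj (x : k) : 0 <= x -> exists r, x = scalar_of r.
Proof.
rewrite /scalar_of; case: s x => [x _|x x0]; first by exists x.
by exists (complex.Re x); rewrite RRe_real// ger0_real.
Qed.

Lemma norm_modulus (z : k) : `|z| = scalar_of (modulus z).
Proof.
by rewrite /scalar_of /modulus; case: s z => //= z; rewrite RRe_real// normr_real.
Qed.

Variable X : normedModType k.
Implicit Types (f g : dual X) (A : set (dual X)) (e : R).

Lemma dual_norm_le f e : 0 <= e -> (dual_norm f <= e%:E)%E <-> dnorm_le f (scalar_of e).
Proof.
move=> e0; have ee0 : 0 <= scalar_of e by rewrite -scalar0 scalar_le.
split=> [H x|H].
  have [->|x0] := eqVneq x 0.
    by rewrite -(scale0r (0 : X)) dual_appZ mul0r normr0 mulr_ge0.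
  have nx : 0 < `|x| by rewrite normr_gt0.
  rewrite -ler_pdivrMr// -[`|x|^-1]gtr0_norm ?invr_gt0// mulrC -normrM -dual_appZ.
  rewrite norm_modulus scalar_le -lee_fin; apply: le_trans H; apply: ereal_sup_ubound.
  exists (`|x|^-1 *: x) => //=.
  by rewrite normrZ gtr0_norm ?invr_gt0// mulVf ?gt_eqF.
apply: ge_ereal_sup => _ [x /= x1 <-]; rewrite lee_fin -scalar_le -norm_modulus.
by apply: le_trans (H x) _; rewrite ler_piMr.
Qed.

Lemma norm_diam_le A e : 0 <= e ->
  (norm_diam A <= e%:E)%E <-> forall f g, A f -> A g -> dnorm_le (f - g) (scalar_of e).
Proof.
move=> e0; split=> [H f g Af Ag|H].
  apply/dual_norm_le => //; apply: le_trans H; apply: ereal_sup_ubound.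
  by exists (f, g).
by apply: ge_ereal_sup => _ [[f g] [/= Af Ag] <-]; apply/dual_norm_le => //; exact: H.
Qed.

Lemma ball_sub_szlenk_derivation e A : 0 <= e ->
  ball_derivation (scalar_of e) A `<=` szlenk_derivation e A.
Proof.
move=> e0 f [Af H]; split=> // V Vf; rewrite ltNge; apply/negP.
move=> /(norm_diam_le _ e0) VA; apply: (H V Vf).
exists [:: f] => g VAg; exists f; first exact: mem_head.
by apply: VA => //; split=> //; exact: (@nbhs_singleton (weak_star X)).
Qed.

(** Near [f], the balls not containing [f] are avoided. Points of the remaining balls are within
    [2e] of [f], hence within [4e] of each other. *)
Lemma szlenk_sub_ball_derivation e A : 0 <= e ->
  szlenk_derivation ((e + e) + (e + e)) A `<=` ball_derivation (scalar_of e) A.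
Proof.
move=> e0 f [Af H]; split=> // V Vf [P HP].
have ee0 : 0 <= scalar_of e by rewrite -scalar0 scalar_le.
pose U : set (dual X) :=
  [set h | forall p, p \in P -> dnorm_le (h - p) (scalar_of e) -> dnorm_le (f - p) (scalar_of e)].
have Uf : nbhs (f : weak_star X) (V `&` U).
  by apply: filterI => //; exact: nbhs_not_close.
suff /(lt_le_trans (H _ Uf)) :
    (norm_diam ((V `&` U) `&` A) <= (e + e + (e + e))%:E)%E by rewrite ltxx.
apply/norm_diam_le; first by rewrite !addr_ge0.
have near g : ((V `&` U) `&` A) g -> dnorm_le (g - f) (scalar_of (e + e)).
  move=> [[Vg gP] Ag]; have [p pP gp] := HP g (conj Vg Ag).
  by rewrite scalarD; exact: dnorm_le_trans gp (dnorm_le_sym (gP p pP gp)).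
move=> g h /near gf /near hf.
by rewrite scalarD; apply: dnorm_le_trans gf _; exact: dnorm_le_sym.
Qed.

Lemma szlenk_mono e A B : 0 <= e -> A `<=` B ->
  szlenk_derivation e A `<=` szlenk_derivation e B.
Proof.
move=> e0 AB f [Af H]; split=> [|V Vf]; first exact: AB.
rewrite ltNge; apply/negP => /(norm_diam_le _ e0) VB.
suff /(lt_le_trans (H V Vf)) : (norm_diam (V `&` A) <= e%:E)%E by rewrite ltxx.
apply/norm_diam_le => // g h [Vg Ag] [Vh Ah].
by apply: VB; split=> //; exact: AB.
Qed.

Lemma szlenk_eps_le e A a : eole (szlenk_eps e A) (Some a) <-> szlenk_derived e A a = set0.
Proof.
have dK (B : set (dual X)) : szlenk_derivation e B `<=` B by move=> f [].
rewrite /szlenk_eps; case E : (oleast _) => [b|] /=.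
  have [b0 bmin] := (oleast_SomeP _ _).1 E.
  split=> [ba|]; last exact: bmin.
  exact: (derived_empty dK ba b0).
by split=> // H; have /oleast_NoneP/(_ a) := E.
Qed.

(** The two derivations agree up to a factor 4 in the radius, which is harmless because all positive
    radii are considered. *)
Lemma szlenk_vanishes A : szlenk A = oleast (vanishes A).
Proof.
rewrite /szlenk; congr oleast; apply/funext => a; apply/propext.
split=> [H e e0|H e e0].
  have [r E] := scalar_surj (ltW e0); rewrite E in e0 *.
  rewrite scalar_gt0 in e0; rewrite -subset0 -((szlenk_eps_le _ _ _).1 (H r e0)) => f Af.
  apply: (derived_rel (rho := eq) (d := ball_derivation (scalar_of r)) (A := A)) erefl Af.
    move=> S S' SS x _ <- /(ball_sub_szlenk_derivation (ltW e0)).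
    apply: szlenk_mono => [|y]; first exact: ltW.
    exact: (SS y y erefl).
  by move=> x _ <-.
apply/szlenk_eps_le; pose q := e / 4.
have q0 : 0 < q by rewrite divr_gt0.
have Eq : e = (q + q) + (q + q) by rewrite /q; field.
have eq0 : 0 < scalar_of q by rewrite scalar_gt0.
rewrite -subset0 -(H _ eq0) Eq => f Af.
apply: (derived_rel (rho := eq) (d := szlenk_derivation (q + q + (q + q))) (A := A)) erefl Af.
  move=> S S' SS x _ <- /(szlenk_sub_ball_derivation (ltW q0)); apply: ball_derivation_mono => // y.
  exact: (SS y y erefl).
by move=> x _ <-.
Qed.

End norm_diameter.

Theorem theorem1p1 (R : realType) (s : scalar_kind)
    (X : completeNormedModType (scalars R s)) (K : set (dual X))
    (hK : @compact (weak_star X) K) :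
  szlenk (weak_star_closed_convex_hull K) = Gamma (szlenk K).
Proof.
rewrite !szlenk_vanishes; set L := weak_star_closed_convex_hull K.
have LK a : vanishes L a -> vanishes K a.
  move=> La e e0; rewrite -subset0 -(La e e0); apply: ball_derived_mono => //.
  exact: sub_wscl.
case E : (oleast (vanishes K)) => [a|]; last first.
  by apply/oleast_NoneP => a /LK Ka; have /oleast_NoneP/(_ a) := E.
have [Ka amin] := (oleast_SomeP _ _).1 E.
have [g Eg] := Gamma_finite a; rewrite Eg.
have [[gg ag] gmin] := (oleast_SomeP _ _).1 Eg.
have Lg : vanishes L g.
  move=> e e0; have e2 : 0 < e / 2 by exact: divr_gt0.
  apply: (hull_decay_gamma gg hK (ltW e2)); last first.
    exact: (derived_empty (@ball_derivationK _ _ (e / 2)) ag (Ka _ e2)).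
  by rewrite ltr_pdivrMr// ltr_pMr// ltr1n.
apply/oleast_SomeP; split=> // b Lb.
(* The least [l] at which [L] vanishes is a gamma number, and [a <= l] because [K] vanishes there
   too; hence [g <= l]. *)
have [l El] := oleast_ex Lg.
have [Ll lmin] := (oleast_SomeP _ _).1 El.
apply: (ole_trans (b := l)); last exact: lmin.
apply: gmin; split; last exact/amin/LK.
exact: vanishes_least_gamma (@wscl_cvx _ _ K) Ll lmin.
Qed.
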